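(* Let $\sigma,\zeta$ be the Weierstrass sigma and zeta functions for a lattice $2\omega_1\mathbb Z+2\omega_2\mathbb Z$ with $\mathrm{Im}(\omega_2/\omega_1)>0$, and $\Phi(x,\alpha)=\frac{\sigma(x-\alpha)}{\sigma(x)\sigma(\alpha)}e^{x\zeta(\alpha)}$. For every $n\ge1$, as an identity of meromorphic functions of $x,\alpha_1,\dots,\alpha_n$, $$\frac{\sigma\big(x-\sum_{j=1}^n\alpha_j\big)\prod_{1\le i<j\le n}\sigma(\alpha_i-\alpha_j)}{\sigma(x)\prod_{i=1}^n\sigma(\alpha_i)^n}\,e^{x\sum_{j=1}^n\zeta(\alpha_j)}=\det\Big(\frac{\partial^{i-1}}{\partial x^{i-1}}\Phi(x,\alpha_j)\Big)_{1\le i,j\le n}.$$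
   Context: $\sigma(u)$ is the Weierstrass sigma function of the lattice with periods $2\omega_1,2\omega_2$ and $\zeta(u)=\sigma'(u)/\sigma(u)$. *)

(* Defs.v *)
From HB Require Import structures.
From mathcomp Require Import all_boot all_order all_algebra.
From mathcomp Require Import all_classical all_reals all_analysis.
From mathcomp Require Import complex.
Set Implicit Arguments. Unset Strict Implicit. Unset Printing Implicit Defensive.
Import Order.TTheory GRing.Theory Num.Theory.
Import numFieldTopology.Exports numFieldNormedType.Exports.
Local Open Scope ring_scope.
Local Open Scope complex_scope.
Local Open Scope classical_set_scope.

HB.instance Definition _ (K : realType) :=
  PseudoPointedMetric.copy K[i] (K[i])^o.
HB.instance Definition _ (K : realType) :=
  NormedModule.copy K[i] (K[i])^o.

Section Weierstrass.
Variable K : realType.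
Local Notation C := K[i].

Definition cexp (z : C) : C :=
  (expR (complex.Re z) * cos (complex.Im z)) +i* (expR (complex.Re z) * sin (complex.Im z)).

Definition latt (w1 w2 : C) (m n : int) : C :=
  2%:R * (m%:~R * w1 + n%:~R * w2).

Definition in_lattice (w1 w2 : C) (z : C) : Prop :=
  exists m n : int, z = latt w1 w2 m n.

Definition wfactor (u w : C) : C :=
  (1 - u / w) * cexp (u / w + u ^+ 2 / (2%:R * w ^+ 2)).

(* partial Weierstrass product over the square |m|,|n| <= N, omitting 0 *)
Definition sigma_part (w1 w2 : C) (u : C) (N : nat) : C :=
  u * \prod_(i < (N.*2).+1) \prod_(j < (N.*2).+1)
        (if (i == N :> nat) && (j == N :> nat) then 1
         else wfactor u (latt w1 w2 (i%:Z - N%:Z) (j%:Z - N%:Z))).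

(* Weierstrass sigma function: the (absolutely convergent) product
   sigma(u) = u prod_{w in Lattice\{0}} (1 - u/w) exp(u/w + u^2/(2w^2)) *)
Definition wsigma (w1 w2 : C) (u : C) : C :=
  lim (sigma_part w1 w2 u @ \oo).

Definition wzeta (w1 w2 : C) (u : C) : C :=
  (derive1 (wsigma w1 w2)) u / wsigma w1 w2 u.

Definition Phi (w1 w2 : C) (x a : C) : C :=
  wsigma w1 w2 (x - a) / (wsigma w1 w2 x * wsigma w1 w2 a)
  * cexp (x * wzeta w1 w2 a).

End Weierstrass.

(* Main.v *)
(* As functions of [x] the columns give a Wronskian. Dividing its functions by the
   first one and differentiating lowers its size by one, and the addition formula
     zeta(x-b) + zeta(b) - zeta(x-a) - zeta(a)
       = sigma(x) sigma(a-b) sigma(x-a-b) / (sigma(a) sigma(b) sigma(x-a) sigma(x-b))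
   turns (Phi(x,a_j) / Phi(x,a_1))' into a constant times a factor independent of j
   times Phi(x-a_1,a_j); so the identity follows by induction on [n], with
   continuity in [x] at the points where x-a_1 is a period. The difference of the
   two sides of the addition formula is, as a function of [b], elliptic with
   removable singularities, hence constant, and it vanishes at b = a. Ellipticity
   comes from the relation, valid for a period L whenever u+v = u'+v',
     sigma(u+L) sigma(v+L) sigma(u') sigma(v')
       = sigma(u) sigma(v) sigma(u'+L) sigma(v'+L),
   in which the exponential factors of the partial products cancel and the rest
   telescopes to boundary terms tending to 1. No integration is needed: the maximum
   principle, proved by a second-difference argument, bounds difference quotients,
   which gives Liouville's theorem and the smoothness of locally uniform limits. *)

(* Two obstacles shape the proof. Without contour integrals, holomorphy needs a form for which sums,
   products, composition and locally uniform limits are elementary; iterated difference quotients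
   have this form, because dividing by [z - p] can be controlled on a far circle and the maximum
   principle brings the bound inside. The second obstacle is that sigma is a limit over squares of
   indices, which no period preserves. The classical multiplier of sigma under a period L is the
   exponential of an affine function of u; two such multipliers depend on u + v only, which is why a
   relation between four points with equal sums can avoid naming any quasi-period constant. Taking
   u' = u + t, v' = v - t and differentiating at t = 0 then gives the periodicity of differences of
   zeta, and this is all that the addition formula needs besides the relation itself. The lattice
   enters the estimates on products through the single lower bound [gap], which is symmetric in the
   two periods, so the period 2 w2 is obtained from 2 w1 by exchange. *)
Require Import Defs.
From HB Require Import structures.
From mathcomp Require Import all_boot all_order all_algebra.
From mathcomp Require Import all_classical all_reals all_analysis.
From mathcomp Require Import perm complex ring lra zify.
Set Implicit Arguments. Unset Strict Implicit. Unset Printing Implicit Defensive.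
Import Order.TTheory GRing.Theory Num.Theory.
Import numFieldTopology.Exports numFieldNormedType.Exports.
Local Open Scope ring_scope.
Local Open Scope complex_scope.
Local Open Scope classical_set_scope.

(** * Complex modulus, limits and compact discs *)

Section Modulus.
Variable K : realType.
Implicit Types (z w : K[i]) (e d r : K).

(* The norm of [K[i]] takes values in [K[i]]; [nm] is the same number in [K]. *)
Definition nm z : K := complex.Re `|z|.

Lemma normE z : `|z| = (nm z)%:C.
Proof. by rewrite /nm normc_def. Qed.

Lemma nm_ge0 z : 0 <= nm z.
Proof. by rewrite -ler0c -normE normr_ge0. Qed.

Lemma nmM z w : nm (z * w) = nm z * nm w.
Proof. by apply: complexI; rewrite rmorphM -!normE normrM. Qed.

Lemma nmV z : nm z^-1 = (nm z)^-1.
Proof. by apply: complexI; rewrite fmorphV -!normE normfV. Qed.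

Lemma nmX z n : nm (z ^+ n) = nm z ^+ n.
Proof. by apply: complexI; rewrite rmorphXn -!normE normrX. Qed.

Lemma nmN z : nm (- z) = nm z.
Proof. by rewrite /nm normrN. Qed.

Lemma nmC z w : nm (z - w) = nm (w - z).
Proof. by rewrite -nmN opprB. Qed.

Lemma nm0 : nm 0 = 0 :> K. Proof. by rewrite /nm normr0. Qed.
Lemma nm1 : nm 1 = 1 :> K. Proof. by rewrite /nm normr1. Qed.

Lemma nmD z w : nm (z + w) <= nm z + nm w.
Proof. by rewrite -lecR rmorphD/= -!normE ler_normD. Qed.

Lemma nmB z w : nm (z - w) <= nm z + nm w.
Proof. by rewrite (le_trans (nmD _ _))// nmN. Qed.

Lemma nm_eq0 z : (nm z == 0) = (z == 0).
Proof.
apply/eqP/eqP => [z0|->]; last exact: nm0.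
by apply: (@normr0_eq0 K[i] K[i]); rewrite normE z0.
Qed.

Lemma nm_gt0 z : (0 < nm z) = (z != 0).
Proof. by rewrite lt_neqAle nm_ge0 andbT eq_sym nm_eq0. Qed.

Lemma nm_le0 z : nm z <= 0 -> z = 0.
Proof. by move=> h; apply/eqP; rewrite -nm_eq0 eq_le h nm_ge0. Qed.

Lemma nm_real r : nm r%:C = `|r|.
Proof. by rewrite /nm normc_def /= expr0n /= addr0 sqrtr_sqr. Qed.

Lemma nm_i : nm ('i)%C = 1 :> K.
Proof. by rewrite /nm normc_def /= expr0n /= add0r expr1n sqrtr1. Qed.

Lemma nm_Re z : `|complex.Re z| <= nm z.
Proof. by rewrite -lecR -normE normc_ge_Re. Qed.

Lemma nm_Im z : `|complex.Im z| <= nm z.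
Proof.
by rewrite -[nm z]mul1r -nm_i -nmM -normrN -ReiNIm mulrC nm_Re.
Qed.

Lemma nm_ReIm z : nm z <= `|complex.Re z| + `|complex.Im z|.
Proof.
rewrite [X in nm X]complexE (le_trans (nmD _ _))// nmM nm_i mul1r.
by rewrite !nm_real.
Qed.

Lemma nm_sqr z : nm z ^+ 2 = complex.Re z ^+ 2 + complex.Im z ^+ 2.
Proof.
by have := add_Re2_Im2 z; rewrite normE -rmorphXn => /complexI.
Qed.

Lemma nm_nat n : nm n%:R = n%:R :> K.
Proof. by rewrite -(rmorph_nat (real_complex K)) nm_real normr_nat. Qed.

Lemma gt0_complex (e : K[i]) : 0 < e -> exists2 d, 0 < d & e = d%:C.
Proof.
case: e => a b; rewrite ltcE /= => /andP[/eqP b0 a0]; exists a => //.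
by rewrite b0.
Qed.

Lemma near_disc (p : K[i]) (P : K[i] -> Prop) :
  (\forall z \near p, P z) <-> exists2 d, 0 < d & forall z, nm (z - p) < d -> P z.
Proof.
split.
  move=> /nbhs_normP[e /= /gt0_complex[d d0 ->] h]; exists d => // z zd.
  by apply: h => /=; rewrite normE nmC ltcR.
move=> [d d0 h]; apply/nbhs_normP; exists d%:C; first by rewrite /= ltcR.
by move=> z /=; rewrite normE nmC ltcR => /h.
Qed.

Lemma continuous_disc (f : K[i] -> K[i]) (p : K[i]) :
  {for p, continuous f} <-> forall e, 0 < e ->
  exists2 d, 0 < d & forall z, nm (z - p) < d -> nm (f z - f p) < e.
Proof.
have E := @cvgrPdistC_lt _ K[i] _ (nbhs p) _ f (f p).
split.
  move=> /E cf e e0.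
  have := cf e%:C; rewrite ltcR => /(_ e0) /near_disc[d d0 H].
  by exists d => // z /H /=; rewrite normE ltcR.
move=> cf; apply/E => _ /gt0_complex[e e0 ->].
have [d d0 H] := cf e e0; apply/near_disc; exists d => // z /H.
by rewrite /= normE ltcR.
Qed.

Lemma cvg_disc (u : nat -> K[i]) (l : K[i]) :
  u @ \oo --> l <-> forall e, 0 < e ->
  exists N, forall n, (N <= n)%N -> nm (u n - l) < e.
Proof.
split.
  move=> /cvgrPdistC_lt cu e e0.
  have := cu e%:C; rewrite ltcR => /(_ e0) [N _ H]; exists N => n Nn.
  by have := H n Nn; rewrite /= normE ltcR.
move=> cu; apply/cvgrPdistC_lt => _ /gt0_complex[e e0 ->].
have [N H] := cu e e0; exists N => // n /= Nn.
by rewrite normE ltcR H.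
Qed.

Lemma cvg_limC (u : nat -> K[i]) (l : K[i]) : u @ \oo --> l -> lim (u @ \oo) = l.
Proof. by apply: cvg_lim; exact: norm_hausdorff. Qed.

Lemma cvg_uniqueC (u : nat -> K[i]) (l l' : K[i]) :
  u @ \oo --> l -> u @ \oo --> l' -> l = l'.
Proof. by move=> /cvg_limC <- /cvg_limC <-. Qed.

(** Completeness is inherited from [K] through the real and imaginary parts, both of which are
    1-Lipschitz for [nm]. *)
Lemma cauchy_cvgC (u : nat -> K[i]) :
  (forall e, 0 < e -> exists N, forall n m, (N <= n)%N -> (N <= m)%N ->
     nm (u n - u m) < e) ->
  u @ \oo --> lim (u @ \oo).
Proof.
move=> cu.
have cvg_part (g : K[i] -> K) : (forall z w, g (z - w) = g z - g w) ->
    (forall z, `|g z| <= nm z) -> exists l : K, g \o u @ \oo --> l.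
  move=> gB gn; apply/cvg_ex/cauchy_cvgP/cauchy_exP => e e0.
  have [N H] := cu e e0; exists (g (u N)).
  exists N => // n /= Nn; rewrite /ball /= -gB (le_lt_trans (gn _))// H//.
have [a /cvgrPdistC_lt ca] := cvg_part (@complex.Re K) (raddfB _) (@nm_Re).
have [b /cvgrPdistC_lt cb] := cvg_part (@complex.Im K) (raddfB _) (@nm_Im).
apply/cvg_ex; exists (a +i* b); apply/cvg_disc => e e0.
have e2 : 0 < e / 2 by rewrite divr_gt0.
have [N1 _ H1] := ca _ e2; have [N2 _ H2] := cb _ e2.
exists (maxn N1 N2) => n; rewrite geq_max => /andP[n1 n2].
rewrite (le_lt_trans (nm_ReIm _))// (splitr e) ltrD//.
  by have := H1 n n1; rewrite /=; case: (u n).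
by have := H2 n n2; rewrite /=; case: (u n).
Qed.

End Modulus.

(** * Compactness of closed discs and bounds for continuous functions on them *)

Section Compactness.
Variable K : realType.
Implicit Types (z w p c : K[i]) (e d r M : K).

Lemma continuous_lip (T : pseudoMetricType K) (f : T -> K[i]) (p : T) :
  (forall e, 0 < e -> \forall x \near p, nm (f x - f p) < e) ->
  {for p, continuous f}.
Proof.
move=> cf; apply/(@cvgrPdistC_lt _ K[i] _ (nbhs p) _ f (f p)).
move=> _ /gt0_complex[e e0 ->]; have := cf e e0.
by apply: filterS => z /=; rewrite normE ltcR.
Qed.

Lemma continuous_lipK (f : K[i] -> K) (p : K[i]) :
  (forall z, `|f z - f p| <= nm (z - p)) -> {for p, continuous f}.
Proof.
move=> cf; apply/(@cvgrPdistC_lt _ K _ (nbhs p) _ f (f p)) => e e0.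
by apply/near_disc; exists e => // z; exact: le_lt_trans.
Qed.

Lemma nm_lip z p : `|nm z - nm p| <= nm (z - p).
Proof.
rewrite ler_norml; have := nmD (z - p) p; have := nmD (p - z) z.
rewrite !subrK (nmC p); lra.
Qed.

Lemma nm_continuous : continuous (@nm K).
Proof. by move=> p; apply: continuous_lipK => z; exact: nm_lip. Qed.

Lemma Re_continuous : continuous (@complex.Re K).
Proof. by move=> p; apply: continuous_lipK => z; rewrite -raddfB nm_Re. Qed.

Definition disc c r : set K[i] := [set z | nm (z - c) <= r].

(** The disc is a closed subset of a square, and the square is a continuous image of a product of
    two compact real segments. *)
Lemma disc_compact c r : compact (disc c r).
Proof.
pose f (x : K * K) : K[i] := x.1 +i* x.2.
pose a := complex.Re c; pose b := complex.Im c.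
have cf : continuous f.
  move=> -[x y]; apply: continuous_lip => e e0.
  have e2 : 0 < e / 2 by rewrite divr_gt0.
  apply: filterS (nbhsx_ballx (x, y) _ e2) => -[x' y'] [/= h1 h2].
  rewrite (le_lt_trans (nm_ReIm _))// (splitr e) ltrD//= distrC //.
have cpt : compact (f @` (`[a - r, a + r] `*` `[b - r, b + r])).
  apply: continuous_compact; first exact: continuous_subspaceT.
  by apply: compact_setX; exact: segment_compact.
apply: (@subclosed_compact _ _ _ _ cpt).
  have -> : disc c r = (fun z => nm (z - c)) @^-1` [set x | x <= r] by [].
  apply: closed_comp; last exact: closed_le.
  move=> z _; apply: continuous_lipK => w.
  by rewrite (le_trans (nm_lip _ _))// opprB addrA subrK.
move=> z /= zc; exists (complex.Re z, complex.Im z); last by case: (z).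
have := le_trans (nm_Re _) zc; have := le_trans (nm_Im _) zc.
rewrite !raddfB -/a -/b !ler_norml => h1 h2.
by split; rewrite /= in_itv /=; lra.
Qed.

Lemma disc_max (f : K[i] -> K) c r : 0 <= r ->
  (forall z, nm (z - c) <= r -> {for z, continuous f}) ->
  exists2 q, nm (q - c) <= r & forall z, nm (z - c) <= r -> f z <= f q.
Proof.
move=> r0 cf.
have [|||q /set_mem qc H] := @compact_EVT_max _ K f (disc c r).
- by exists c; rewrite /disc /= subrr nm0.
- exact: disc_compact.
- by apply: continuous_in_subspaceT => z /set_mem; exact: cf.
by exists q => // z zc; apply: H; apply/mem_set.
Qed.

Lemma disc_bounded (f : K[i] -> K[i]) c r : 0 <= r ->
  (forall z, nm (z - c) <= r -> {for z, continuous f}) ->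
  exists2 M, 0 <= M & forall z, nm (z - c) <= r -> nm (f z) <= M.
Proof.
move=> r0 cf; have [|q qc H] := @disc_max (fun z => nm (f z)) c r r0.
  move=> z /cf cz; apply: (@continuous_comp _ _ _ f (@nm K)) => //.
  exact: nm_continuous.
by exists (nm (f q)) => //; exact: nm_ge0.
Qed.

End Compactness.

(** * Iterated difference quotients *)

Section Regular.
Variable K : realType.
Local Notation C := K[i].
Implicit Types (z w p c : C) (e d r M : K) (f g : C -> C).

(* [reg k f p]: near [p] the difference quotient at [p] can be taken [k] times,
   ending with a function continuous at [p]. This replaces Taylor expansions and
   is stable under locally uniform limits. *)
Fixpoint reg k f p : Prop :=
  if k is k'.+1 then
    exists2 g, reg k' g p & \forall z \near p, f z = f p + (z - p) * g z
  else {for p, continuous f}.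

Definition smooth f p := forall k, reg k f p.

Lemma near_self p (P : C -> Prop) : (\forall z \near p, P z) -> P p.
Proof. by move=> /near_disc[d d0]; apply; rewrite subrr nm0. Qed.

Lemma continuous_cstC c p : {for p, continuous (fun _ : C => c)}.
Proof. exact: cst_continuous. Qed.

Lemma continuous_idC p : {for p, continuous (fun z : C => z)}.
Proof. by move=> ? h; exact: h. Qed.

Lemma continuousDC f g p : {for p, continuous f} -> {for p, continuous g} ->
  {for p, continuous (fun z => f z + g z)}.
Proof. by move=> cf cg; have := continuousD cf cg. Qed.

Lemma continuousMC f g p : {for p, continuous f} -> {for p, continuous g} ->
  {for p, continuous (fun z => f z * g z)}.
Proof. by move=> cf cg; have := continuousM cf cg. Qed.

Lemma continuous_subC (q p : C) : {for p, continuous (fun z : C => z - q)}.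
Proof.
exact: (continuousDC (@continuous_idC p) (@continuous_cstC (- q) p)).
Qed.

Lemma near_cvgC (f g : C -> C) p :
  (\forall z \near p, f z = g z) -> {for p, continuous f} ->
  {for p, continuous g}.
Proof.
move=> H /continuous_disc cf; apply/continuous_disc => e /cf[d d0 hd].
have /near_disc[d' d'0 hd'] := H.
exists (Num.min d d'); first by rewrite lt_min d0.
move=> z; rewrite lt_min => /andP[zd zd'].
by rewrite -(hd' z zd') -(near_self H) hd.
Qed.

Lemma reg_near k f g p :
  (\forall z \near p, f z = g z) -> reg k f p -> reg k g p.
Proof.
case: k => [|k] H; first exact: near_cvgC.
move=> [h rh fh]; exists h => //; rewrite -(near_self H).
by apply: filterS2 H fh => z <- <-.
Qed.

Lemma reg_continuous k f p : reg k f p -> {for p, continuous f}.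
Proof.
elim: k f => [//|k IH] f [g /IH cg H].
apply: (@near_cvgC (fun z => f p + (z - p) * g z)).
  by apply: filterS H => z ->.
apply: (continuousDC (@continuous_cstC _ _)).
exact: (continuousMC (@continuous_subC _ _) cg).
Qed.

Lemma regW k f p : reg k.+1 f p -> reg k f p.
Proof.
elim: k f => [|k IH] f; first exact: reg_continuous.
by move=> [g /IH rg H]; exists g.
Qed.

Lemma reg_cst k c p : reg k (fun=> c) p.
Proof.
elim: k c => [|k IH] c; first exact: continuous_cstC.
by exists (fun=> 0) => //; near=> z; rewrite mulr0 addr0.
Unshelve. all: end_near. Qed.

Lemma reg_id k p : reg k (fun z => z) p.
Proof.
case: k => [|k]; first exact: continuous_idC.
exists (fun=> 1); first exact: reg_cst.
by near=> z; rewrite mulr1 addrC subrK.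
Unshelve. all: end_near. Qed.

Lemma regD k f g p : reg k f p -> reg k g p -> reg k (fun z => f z + g z) p.
Proof.
elim: k f g => [|k IH] f g; first exact: continuousDC.
move=> [f1 rf hf] [g1 rg hg]; exists (fun z => f1 z + g1 z); first exact: IH.
by apply: filterS2 hf hg => z -> ->; ring.
Qed.

Lemma regM k f g p : reg k f p -> reg k g p -> reg k (fun z => f z * g z) p.
Proof.
elim: k f g => [|k IH] f g; first exact: continuousMC.
move=> rf rg; have rg' := regW rg; case: rf rg => [f1 rf hf] [g1 rg hg].
exists (fun z => f1 z * g z + f p * g1 z).
  by apply: regD; apply: IH => //; exact: reg_cst.
by apply: filterS2 hf hg => z -> hz; rewrite mulrDl {1}hz; ring.
Qed.

Lemma regN k f p : reg k f p -> reg k (fun z => - f z) p.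
Proof.
move=> /(regM (reg_cst k (-1) p)); apply: reg_near.
by near=> z; rewrite mulN1r.
Unshelve. all: end_near. Qed.

Lemma regB k f g p : reg k f p -> reg k g p -> reg k (fun z => f z - g z) p.
Proof. by move=> rf rg; apply: regD => //; exact: regN. Qed.

Lemma near_neq0 f p : {for p, continuous f} -> f p != 0 ->
  \forall z \near p, f z != 0.
Proof.
move=> /continuous_disc cf; rewrite -nm_gt0 => fp0.
have [d d0 hd] := cf _ fp0; apply/near_disc; exists d => // z /hd.
by apply: contraTN => /eqP ->; rewrite sub0r nmN ltxx.
Qed.

Lemma regV k f p : f p != 0 -> reg k f p -> reg k (fun z => (f z)^-1) p.
Proof.
move=> fp0; elim: k => [|k IH]; first exact: continuousV.
move=> rf; have fn0 := near_neq0 (reg_continuous rf) fp0.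
have rV := IH (regW rf); case: rf => [g rg hg].
exists (fun z => - (f p)^-1 * (g z * (f z)^-1)).
  by apply: regM; [exact: reg_cst|exact: regM].
apply: filterS2 fn0 hg => z z0 hz.
have hz' : (z - p) * g z = f z - f p by rewrite hz; ring.
have -> : (z - p) * (- (f p)^-1 * (g z * (f z)^-1))
  = - (f p)^-1 * ((z - p) * g z) * (f z)^-1 by ring.
by rewrite hz'; field; rewrite z0 fp0.
Qed.

Lemma near_comp f p (P : C -> Prop) : {for p, continuous f} ->
  (\forall z \near f p, P z) -> \forall z \near p, P (f z).
Proof.
move=> /continuous_disc cf /near_disc[e /cf[d d0 hd] he].
by apply/near_disc; exists d => // z /hd/he.
Qed.

Lemma reg_comp k f g p : reg k g (f p) -> reg k f p -> reg k (fun z => g (f z)) p.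
Proof.
elim: k f g => [|k IH] f g; first by move=> cg cf; exact: (continuous_comp cf cg).
move=> [h rh hg] rf; have cf := reg_continuous rf.
have rhf := IH f h rh (regW rf); case: rf => [f1 rf1 hf].
exists (fun z => f1 z * h (f z)); first exact: regM.
apply: filterS2 (near_comp cf hg) hf => z -> hz.
by rewrite mulrA; congr (_ + _ * _); rewrite {1}hz addrAC subrr add0r.
Qed.

Lemma derive1_reg f g p : {for p, continuous g} ->
  (\forall z \near p, f z = f p + (z - p) * g z) -> derive1 f p = g p.
Proof.
move=> /continuous_disc cg /near_disc[d d0 hd].
apply: cvg_lim; first exact: norm_hausdorff.
apply/(@cvgrPdistC_lt _ K[i]) => _ /gt0_complex[e e0 ->].
have [d' d'0 hd'] := cg _ e0.
rewrite near_withinE; apply/near_disc; exists (Num.min d d').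
  by rewrite lt_min d0.
move=> h; rewrite subr0 lt_min => /andP[h1 h2] h0; rewrite normE ltcR.
rewrite hd ?addrK// [f p + _]addrC addrK scalerA /= mulVf// scale1r.
by apply: hd'; rewrite addrK.
Qed.

End Regular.

(** * Maximum principle and Liouville's theorem *)

Section Quotient.
Variable K : realType.
Local Notation C := K[i].
Implicit Types (z w p c : C) (e d r M : K) (f g : C -> C).

Lemma derive1_near f g p : (\forall z \near p, f z = g z) ->
  derive1 f p = derive1 g p.
Proof.
move=> H; rewrite /derive1.
have {}H : \forall h \near (0 : C)^',
    h^-1 *: (f (h + p) - f p) = h^-1 *: (g (h + p) - g p).
  have gp := near_self H.
  have /near_disc[d d0 hd] := H.
  rewrite near_withinE; apply/near_disc; exists d => // h; rewrite subr0 => hd' _.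
  by rewrite hd ?addrK// gp.
congr (lim _); apply/seteqP; split; apply: near_eq_cvg => //.
by apply: filterS H => h ->.
Qed.

Lemma derive1n_near n f g p : (\forall z \near p, f z = g z) ->
  \forall z \near p, f^`(n) z = g^`(n) z.
Proof.
move=> H; elim: n => [//|n IH].
have /near_join := IH; apply: filterS => z hz.
exact: derive1_near.
Qed.

Definition dq f p z := if z == p then derive1 f p else (f z - f p) / (z - p).

(** No regularity is involved: at [z = p] the factor [z - p] hides the value of the quotient. *)
Lemma dqE f p z : f z = f p + (z - p) * dq f p z.
Proof.
rewrite /dq; case: eqP => [->|/eqP zp]; first by rewrite subrr mul0r addr0.
by rewrite mulrCA divff ?subr_eq0// mulr1 addrC subrK.
Qed.

Lemma dq_id f p : dq f p p = derive1 f p.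
Proof. by rewrite /dq eqxx. Qed.

(** Off [p] the quotient is forced by division, at [p] by continuity. Hence the local witness in
    [reg] can be exchanged for the globally defined [dq f p]. *)
Lemma dq_unique f g p : {for p, continuous g} ->
  (\forall z \near p, f z = f p + (z - p) * g z) ->
  \forall z \near p, g z = dq f p z.
Proof.
move=> cg H; have fp := derive1_reg cg H; apply: filterS H => z fz.
rewrite /dq; case: eqP => [->//|/eqP zp].
by rewrite fz addrAC subrr add0r mulrC mulKf ?subr_eq0.
Qed.

Lemma reg_dq k f p : reg k.+1 f p -> reg k (dq f p) p.
Proof.
move=> [g rg fg]; apply: reg_near (rg); apply: dq_unique => //.
exact: (reg_continuous rg).
Qed.

Lemma near_neq (q p : C) : q != p -> \forall z \near q, z != p.
Proof.
move=> qp; have := @near_neq0 _ (fun z => z - p) q (@continuous_subC _ _ _).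
by rewrite subr_eq0 => /(_ qp); apply: filterS => z; rewrite subr_eq0.
Qed.

Lemma reg_dq_away k f (q p : C) : q != p -> reg k f q -> reg k (dq f p) q.
Proof.
move=> qp rf.
have : reg k (fun z => (f z - f p) * (z - p)^-1) q.
  apply: regM; first by apply: regB => //; exact: reg_cst.
  apply: regV; first by rewrite subr_eq0.
  by apply: regB; [exact: reg_id|exact: reg_cst].
apply: reg_near; apply: filterS (near_neq qp) => z /negPf zp.
by rewrite /dq zp.
Qed.

Lemma smooth_dq f p (q : C) : smooth f p -> smooth f q -> smooth (dq f p) q.
Proof.
move=> sp sq k; have [->|qp] := eqVneq q p; first exact: reg_dq.
exact: reg_dq_away.
Qed.

Lemma smooth_continuous f p : smooth f p -> {for p, continuous f}.
Proof. by move=> /(_ 0%N). Qed.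

(* At an interior maximum [q] of [Re f + e |z - c|^2], the second-order terms
   of [f] cancel over the four points [q +- t], [q +- i t], while [e |z - c|^2]
   grows by [4 e t^2]. *)
Lemma Re_max f c r M : 0 <= r ->
  (forall z, nm (z - c) <= r -> reg 2 f z) ->
  (forall z, nm (z - c) = r -> complex.Re (f z) <= M) ->
  forall z, nm (z - c) <= r -> complex.Re (f z) <= M.
Proof.
move=> r0 rf bd z zr; apply/ler_addgt0Pr => e' e'0.
(* Chosen so that the perturbation [e |z - c|^2] costs at most [e'] on the disc; the [+ 1] covers
   [r = 0]. *)
pose e := e' / (r ^+ 2 + 1).
have r21 : 0 < r ^+ 2 + 1 by rewrite ltr_wpDl ?sqr_ge0.
have e0 : 0 < e by rewrite divr_gt0.
have er : e * r ^+ 2 <= e'.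
  rewrite /e mulrAC ler_pdivrMr// ler_pM2l//; lra.
pose phi z := complex.Re (f z) + e * nm (z - c) ^+ 2.
have cphi w : nm (w - c) <= r -> {for w, continuous phi}.
  move=> wr; have cR : {for w, continuous (fun z => complex.Re (f z))}.
    apply: (continuous_comp (reg_continuous (rf w wr))).
    exact: Re_continuous.
  have cN : {for w, continuous (fun z : C => nm (z - c))}.
    apply: continuous_lipK => v.
    by rewrite (le_trans (nm_lip _ _))// opprB addrA subrK.
  have ce : {for w, continuous (fun _ : C => e)} by exact: cst_continuous.
  by have := continuousD cR (continuousM ce (continuousM cN cN)).
have [q qr qmax] := disc_max r0 cphi.
have [qr'|] := eqVneq (nm (q - c)) r.
  apply: (@le_trans _ _ (phi q)).
    apply: le_trans (qmax z zr); rewrite lerDl mulr_ge0 ?sqr_ge0//; exact: ltW.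
  by rewrite /phi qr' lerD// bd.
rewrite neq_lt [r < _]ltNge qr orbF => qlt; exfalso.
have [g1 [g2 cg2 h2] h1] := rf q qr.
have e2 : 0 < e / 2 by rewrite divr_gt0.
have /continuous_disc/(_ _ e2)/near_disc h3 := cg2.
have /near_disc[d d0 hd] : \forall z \near q,
    (f z = f q + (z - q) * g1 z /\ g1 z = g1 q + (z - q) * g2 z) /\
    nm (g2 z - g2 q) < e / 2.
  exact: (filterI (filterI h1 h2) h3).
pose t := Num.min d (r - nm (q - c)) / 2.
have m0 : 0 < Num.min d (r - nm (q - c)) by rewrite lt_min d0 subr_gt0.
have t0 : 0 < t by rewrite divr_gt0.
have td : t < d.
  have : Num.min d (r - nm (q - c)) <= d by rewrite ge_min lexx.
  by move: m0; rewrite /t; lra.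
have tr : t <= r - nm (q - c).
  have : Num.min d (r - nm (q - c)) <= r - nm (q - c) by rewrite ge_min lexx orbT.
  by move: m0; rewrite /t; lra.
have step h : nm h = t ->
    [/\ f (q + h) = f q + h * g1 q + h ^+ 2 * g2 (q + h),
        nm (g2 (q + h) - g2 q) < e / 2 & phi (q + h) <= phi q].
  move=> ht; have [|[E1 E2] E3] := hd (q + h).
    by rewrite addrAC subrr add0r ht.
  split => //; last first.
    by apply: qmax; rewrite addrAC (le_trans (nmD _ _))// ht; lra.
  by rewrite E1 E2 addrAC subrr add0r; ring.
have tC : nm t%:C = t by rewrite nm_real gtr0_norm.
have [E1 A1 P1] := step t%:C tC.
have [E2 A2 P2] := step (- t%:C) (etrans (nmN _) tC).
have itC : nm ('i%C * t%:C) = t by rewrite nmM nm_i mul1r.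
have [E3 A3 P3] := step ('i%C * t%:C) itC.
have [E4 A4 P4] := step (- ('i%C * t%:C)) (etrans (nmN _) itC).
(* The squares of the four increments sum to zero, so [g2 q] may be subtracted from each
   second-order coefficient. Each difference left is below [e / 2], so [S] stays below [2 e] and
   cannot compensate the gain [4 e]. *)
have E : f (q + t%:C) + f (q - t%:C) + (f (q + 'i%C * t%:C) + f (q - 'i%C * t%:C))
  = (f q + f q + (f q + f q)) + (t ^+ 2)%:C * ((g2 (q + t%:C) - g2 q) + (g2 (q - t%:C) - g2 q)
     - (g2 (q + 'i%C * t%:C) - g2 q) - (g2 (q - 'i%C * t%:C) - g2 q)).
  rewrite E1 E2 E3 E4 rmorphXn /= !sqrrN exprMn sqr_i; ring.
set S := (g2 _ - _ + _ - _ - _) in E.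
have S2 : - (2 * e) < complex.Re S.
  have : nm S < 2 * e.
    apply: le_lt_trans (nmB _ _) _; have := nmB (g2 (q + t%:C) - g2 q
      + (g2 (q - t%:C) - g2 q)) (g2 (q + 'i%C * t%:C) - g2 q).
    have := nmD (g2 (q + t%:C) - g2 q) (g2 (q - t%:C) - g2 q); lra.
  by move=> /(le_lt_trans (nm_Re S)); rewrite ltr_norml => /andP[].
have {}E := congr1 (@complex.Re K) E.
have ReM (a : K) (w : C) : complex.Re (a%:C * w) = a * complex.Re w.
  by case: w => u v /=; rewrite mul0r subr0.
rewrite !raddfD /= !ReM in E.
have Q : nm (q + t%:C - c) ^+ 2 + nm (q - t%:C - c) ^+ 2 +
    (nm (q + 'i%C * t%:C - c) ^+ 2 + nm (q - 'i%C * t%:C - c) ^+ 2)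
    = 4 * nm (q - c) ^+ 2 + 4 * t ^+ 2.
  by rewrite !nm_sqr; case: (q) (c) => q1 q2 [c1 c2] /=; ring.
have : t ^+ 2 * (complex.Re S + 4 * e) <= 0.
  have Qe := congr1 (fun x => e * x) Q.
  by move: P1 P2 P3 P4 Qe E; rewrite /phi; clear; lra.
rewrite pmulr_rle0 ?exprn_gt0//; lra.
Qed.

(** Multiplying [f] by the conjugate of its value at [z] makes the product real at [z], equal to
    [|f z|^2], and reduces the claim to real parts. *)
Lemma nm_max f c r M : 0 <= r -> 0 <= M ->
  (forall z, nm (z - c) <= r -> reg 2 f z) ->
  (forall z, nm (z - c) = r -> nm (f z) <= M) ->
  forall z, nm (z - c) <= r -> nm (f z) <= M.
Proof.
move=> r0 M0 rf bd z zr; pose w := conjc (f z).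
have nw : nm w = nm (f z) by rewrite /nm -normcJ conjcK.
have [fz0|fz0] := eqVneq (f z) 0; first by rewrite fz0 nm0.
have := @Re_max (fun v => w * f v) c r (nm (f z) * M) r0 _ _ z zr.
have -> : complex.Re (w * f z) = nm (f z) * nm (f z).
  by rewrite -expr2 nm_sqr /w; case: (f z) => a b /=; ring.
rewrite ler_pM2l ?nm_gt0//; apply.
  by move=> v vr; apply: regM; [exact: reg_cst|exact: rf].
move=> v vr; apply: le_trans (ler_norm _) _; apply: le_trans (nm_Re _) _.
by rewrite nmM nw ler_wpM2l ?nm_ge0// bd.
Qed.

Lemma smooth_nm_max f c r M : 0 <= r -> 0 <= M ->
  (forall z, nm (z - c) <= r -> smooth f z) ->
  (forall z, nm (z - c) = r -> nm (f z) <= M) ->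
  forall z, nm (z - c) <= r -> nm (f z) <= M.
Proof. by move=> r0 M0 sf; apply: nm_max => // z /sf. Qed.

(** Substitute for Cauchy's estimate: the bounding circle keeps distance [d] from [p], so there the
    quotient is at most [2 M / d], and the maximum principle carries this bound inside, including to
    the derivative at [p]. *)
Lemma nm_dq_le f p c r d M : 0 <= r -> 0 < d ->
  nm (p - c) + d <= r ->
  (forall z, nm (z - c) <= r -> smooth f z) ->
  (forall z, nm (z - c) <= r -> nm (f z) <= M) ->
  forall z, nm (z - c) <= r -> nm (dq f p z) <= 2 * M / d.
Proof.
move=> r0 d0 pd sf bf.
have pr : nm (p - c) <= r by rewrite (le_trans _ pd)// lerDl ltW.
have M0 : 0 <= M by apply: le_trans (bf p pr); exact: nm_ge0.
have rn0 : 0 <= 2 * M / d by rewrite divr_ge0 ?mulr_ge0// ltW.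
apply: smooth_nm_max => // z zr; first by apply: smooth_dq; exact: sf.
have zp : d <= nm (z - p).
  have := nmD (z - p) (p - c); rewrite addrA subrK zr; lra.
have zp0 : 0 < nm (z - p) by exact: lt_le_trans zp.
have /negPf zp' : z != p by rewrite -subr_eq0 -nm_gt0.
rewrite /dq zp' nmM nmV ler_pM ?invr_ge0 ?nm_ge0//.
  apply: le_trans (nmB _ _) _; have := bf z; have := bf p pr.
  rewrite zr lexx => ? /(_ isT); lra.
by rewrite lef_pV2.
Qed.

Lemma liouville f M : (forall z, smooth f z) ->
  (forall z, nm (f z) <= M) -> forall z w, f z = f w.
Proof.
move=> sf bf z w; rewrite (dqE f w z); suff -> : dq f w z = 0 by rewrite mulr0 addr0.
apply: nm_le0; apply/ler_addgt0Pr => e e0; rewrite add0r.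
have M0 : 0 <= M by apply: le_trans (bf z); exact: nm_ge0.
(* The disc must contain [z], and [2 * M / r] must not exceed [e]. *)
pose r := nm (z - w) + 2 * M / e + 1.
have Me : 0 <= 2 * M / e by rewrite divr_ge0 ?mulr_ge0// ltW.
have r0 : 0 < r by rewrite ltr_wpDl// addr_ge0 ?nm_ge0.
apply: le_trans (@nm_dq_le f w w r r M _ _ _ _ _ z _) _ => //.
- exact: ltW.
- by rewrite subrr nm0 add0r.
- by move: (nm_ge0 (z - w)); rewrite /r; lra.
rewrite ler_pdivrMr// [e * _]mulrC -ler_pdivrMr//.
by move: (nm_ge0 (z - w)); rewrite /r; lra.
Qed.

End Quotient.

(** * Locally uniform limits and derivatives *)

Section Limits.
Variable K : realType.
Local Notation C := K[i].
Implicit Types (z w p c : C) (e d r M : K) (f g : C -> C).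

Definition ucvg (F : nat -> C -> C) f :=
  forall r e, 0 < e -> exists N, forall n, (N <= n)%N ->
    forall z, nm z <= r -> nm (F n z - f z) <= e.

Definition ucauchy (F : nat -> C -> C) :=
  forall r e, 0 < e -> exists N, forall n m, (N <= n)%N -> (N <= m)%N ->
    forall z, nm z <= r -> nm (F n z - F m z) <= e.

Lemma ucvg_cvg F f z : ucvg F f -> F ^~ z @ \oo --> f z.
Proof.
move=> Ff; apply/cvg_disc => e e0.
have e2 : 0 < e / 2 by rewrite divr_gt0.
have [N H] := Ff (nm z) _ e2; exists N => n Nn.
by apply: le_lt_trans (H n Nn z (lexx _)) _; lra.
Qed.

Lemma ucvg_cauchy F f : ucvg F f -> ucauchy F.
Proof.
move=> Ff r e e0; have e2 : 0 < e / 2 by rewrite divr_gt0.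
have [N H] := Ff r _ e2; exists N => n m Nn Nm z zr.
have := nmB (F n z - f z) (F m z - f z).
rewrite opprB addrA subrK; have := H n Nn z zr; have := H m Nm z zr; lra.
Qed.

Lemma ucauchy_ucvg F : ucauchy F -> ucvg F (fun z => lim (F ^~ z @ \oo)).
Proof.
move=> cF; have cvgF z : F ^~ z @ \oo --> lim (F ^~ z @ \oo).
  apply: cauchy_cvgC => e e0; have e2 : 0 < e / 2 by rewrite divr_gt0.
  have [N H] := cF (nm z) _ e2; exists N => n m Nn Nm.
  by apply: le_lt_trans (H n m Nn Nm z (lexx _)) _; lra.
move=> r e e0; have e2 : 0 < e / 2 by rewrite divr_gt0.
have [N H] := cF r _ e2; exists N => n Nn z zr.
have /cvg_disc/(_ _ e2)[N' H'] := cvgF z.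
pose m := maxn N N'.
have := nmD (F n z - F m z) (F m z - lim (F ^~ z @ \oo)).
have := H n m Nn (leq_maxl _ _) z zr; have := H' m (leq_maxr _ _).
by rewrite addrA subrK; lra.
Qed.

(* By the maximum principle the difference quotients of a locally uniformly
   convergent sequence converge locally uniformly too. *)
Lemma reg_lim k F f : (forall n z, smooth (F n) z) -> ucvg F f ->
  forall p, reg k f p.
Proof.
elim: k F f => [|k IH] F f sF Ff p.
  apply/continuous_disc => e e0; have e3 : 0 < e / 3 by rewrite divr_gt0.
  have [N H] := Ff (nm p + 1) _ e3.
  have /continuous_disc/(_ _ e3)[d d0 hd] := smooth_continuous (sF N p).
  exists (Num.min d 1); first by rewrite lt_min d0 ltr01.
  move=> z; rewrite lt_min => /andP[zd z1].
  have zp := nmD (z - p) p; rewrite subrK in zp.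
  have h1 : nm (F N z - f z) <= e / 3 by apply: H => //; lra.
  have h2 : nm (F N p - f p) <= e / 3 by apply: H => //; lra.
  have h3 := hd z zd.
  have := nmD (f z - F N z) (F N z - F N p).
  have := nmD (f z - F N z + (F N z - F N p)) (F N p - f p).
  have -> : f z - F N z + (F N z - F N p) + (F N p - f p) = f z - f p by ring.
  rewrite (nmC (f z) (F N z)). lra.
pose G n := dq (F n) p.
have sG n z : smooth (G n) z by exact: smooth_dq.
have /ucauchy_ucvg Gg : ucauchy G.
  (* The circle of radius [R] encloses the points with [nm z <= r] and stays at distance at least 1
     from [p], so dividing by [v - p] there does not enlarge the error. The maximum with 0 covers
     negative [r]. *)
  move=> r e e0; pose R := Num.max r 0 + nm p + 1.
  have e2 : 0 < e / 2 by rewrite divr_gt0.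
  have r0 : 0 <= Num.max r 0 by rewrite le_max lexx orbT.
  have p0 := nm_ge0 p.
  have [N H] := ucvg_cauchy Ff R e2; exists N => n m Nn Nm z zr.
  have zR : nm (z - 0) <= R.
    have : r <= Num.max r 0 by rewrite le_max lexx.
    by rewrite subr0 /R; lra.
  have R0 : 0 <= R by rewrite /R; lra.
  apply: (@smooth_nm_max _ (fun v => G n v - G m v) 0 R e R0 _ _ _ z zR).
  - exact: ltW.
  - by move=> v _ j; apply: regB; exact: sG.
  move=> v; rewrite subr0 => vR; have zp := nmD (v - p) p.
  rewrite subrK vR in zp; have zp1 : 1 <= nm (v - p) by move: zp; rewrite /R; lra.
  have zp0 : 0 < nm (v - p) by exact: lt_le_trans zp1.
  have /negPf vp : v != p by rewrite -subr_eq0 -nm_gt0.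
  rewrite /G /dq vp -mulrBl nmM nmV ler_pdivrMr//.
  have h1 : nm (F n v - F m v) <= e / 2 by apply: H => //; rewrite vR.
  have h2 : nm (F n p - F m p) <= e / 2 by apply: H => //; rewrite /R; lra.
  have := nmB (F n v - F m v) (F n p - F m p).
  have -> : F n v - F m v - (F n p - F m p) = F n v - F n p - (F m v - F m p) by ring.
  have : e <= e * nm (v - p) by rewrite ler_peMr// ltW.
  lra.
exists (fun z => lim (G ^~ z @ \oo)); first exact: (IH _ _ sG Gg p).
(* Pass to the limit in [F n z = F n p + (z - p) * G n z]. *)
near=> z; apply: (@cvg_uniqueC _ (F ^~ z)); first exact: ucvg_cvg.
have -> : F ^~ z = (fun n => F n p + (z - p) * G n z).
  by apply/funext => n; exact: dqE.
apply: cvgD; first exact: ucvg_cvg.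
apply: cvgM; first exact: cvg_cst. exact: (@ucvg_cvg _ _ z Gg).
Unshelve. all: end_near. Qed.

Lemma smooth_lim F f : (forall n z, smooth (F n) z) -> ucvg F f ->
  forall p, smooth f p.
Proof. by move=> sF Ff p k; exact: (reg_lim k sF Ff). Qed.

End Limits.

(** * Rules for [derive1] and holomorphy on a neighbourhood *)

Section Derivatives.
Variable K : realType.
Local Notation C := K[i].
Implicit Types (z w p c : C) (e d r M : K) (f g : C -> C).

Lemma derive1_dq f g p : {for p, continuous g} ->
  (forall z, f z = f p + (z - p) * g z) -> derive1 f p = g p.
Proof.
move=> cg H; apply: derive1_reg => //.
by near=> z; exact: H.
Unshelve. all: end_near. Qed.

Lemma cdq f p : reg 1 f p -> {for p, continuous (dq f p)}.
Proof. by move=> rf; have := reg_dq rf. Qed.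

Lemma derive1D f g p : reg 1 f p -> reg 1 g p ->
  derive1 (fun z => f z + g z) p = derive1 f p + derive1 g p.
Proof.
move=> /cdq cf /cdq cg.
apply: (etrans (@derive1_dq _ (fun z => dq f p z + dq g p z) p _ _));
  last by rewrite !dq_id.
  exact: (continuousDC cf cg).
by move=> z; rewrite {1}(dqE f p z) {1}(dqE g p z); ring.
Qed.

Lemma derive1M f g p : reg 1 f p -> reg 1 g p ->
  derive1 (fun z => f z * g z) p = derive1 f p * g p + f p * derive1 g p.
Proof.
move=> rf rg; have cf := cdq rf; have cg := cdq rg.
apply: (etrans (@derive1_dq _ (fun z => dq f p z * g z + f p * dq g p z) p _ _));
  last by rewrite !dq_id.
  exact: (continuousDC (continuousMC cf (reg_continuous rg))
    (continuousMC (@continuous_cstC _ _ _) cg)).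
by move=> z; rewrite {1}(dqE f p z) mulrDl {1}(dqE g p z); ring.
Qed.

Lemma derive1C c p : derive1 (fun _ : C => c) p = 0.
Proof.
apply: (@derive1_dq _ (fun=> 0)); first exact: continuous_cstC.
by move=> z; rewrite mulr0 addr0.
Qed.

Lemma derive1_idC p : derive1 (fun z : C => z) p = 1.
Proof.
apply: (@derive1_dq _ (fun=> 1)); first exact: continuous_cstC.
by move=> z; rewrite mulr1 addrC subrK.
Qed.

Lemma derive1Z c f p : reg 1 f p -> derive1 (fun z => c * f z) p = c * derive1 f p.
Proof.
by move=> rf; rewrite (derive1M (reg_cst 1 c p) rf) derive1C mul0r add0r.
Qed.

Lemma derive1_oppC f p : reg 1 f p -> derive1 (fun z => - f z) p = - derive1 f p.
Proof.
move=> rf; have -> : (fun z => - f z) = (fun z => -1 * f z).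
  by apply/funext => z; rewrite mulN1r.
by rewrite (derive1Z (-1) rf) mulN1r.
Qed.

Lemma derive1B f g p : reg 1 f p -> reg 1 g p ->
  derive1 (fun z => f z - g z) p = derive1 f p - derive1 g p.
Proof. by move=> rf rg; rewrite (derive1D rf (regN rg)) derive1_oppC. Qed.

Lemma derive1_chain g f p : reg 1 g (f p) -> reg 1 f p ->
  derive1 (fun z => g (f z)) p = derive1 g (f p) * derive1 f p.
Proof.
move=> rg rf; have cf := cdq rf; have cg := cdq rg.
apply: (etrans (@derive1_dq _ (fun z => dq g (f p) (f z) * dq f p z) p _ _));
  last by rewrite !dq_id.
  exact: (continuousMC (continuous_comp (reg_continuous rf) cg) cf).
move=> z; rewrite {1}(dqE g (f p) (f z)); congr (_ + _).
by rewrite {1}(dqE f p z); ring.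
Qed.

Lemma derive1V f p : f p != 0 -> reg 1 f p ->
  derive1 (fun z => (f z)^-1) p = - derive1 f p / f p ^+ 2.
Proof.
move=> fp0 rf; have rV := regV fp0 rf.
have : derive1 (fun z => (f z)^-1 * f z) p = derive1 (fun=> 1 : C) p.
  apply: derive1_near; apply: filterS (near_neq0 (reg_continuous rf) fp0) => z z0.
  by rewrite mulVf.
rewrite derive1C (derive1M rV rf) => E.
apply: (mulIf fp0); rewrite (_ : _ * f p = - ((f p)^-1 * derive1 f p)).
  by field; exact: fp0.
by move/eqP: E; rewrite addr_eq0 => /eqP ->.
Qed.

Lemma smooth_nm_derive1 f c r M z : 0 < r ->
  (forall z, nm (z - c) <= r -> smooth f z) ->
  (forall z, nm (z - c) <= r -> nm (f z) <= M) ->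
  nm (z - c) <= r / 2 -> nm (derive1 f z) <= 2 * M / (r / 2).
Proof.
move=> r0 sf bf zr; rewrite -dq_id; apply: (@nm_dq_le _ f z c r) => //.
- exact: ltW.
- by rewrite divr_gt0.
- by lra.
- by lra.
Qed.

(** With [g = dq f p], differentiating [f = f p + (z - p) g] gives [f' = g + (z - p) g']. For
    [k = 0] it suffices that [g'] is bounded near [p]; in the inductive step the quotient of [f'] at
    [p] is [dq g p + g'], and the induction hypothesis applies to [g]. *)
Lemma reg_derive1 k f p : (\forall z \near p, smooth f z) -> reg k (derive1 f) p.
Proof.
elim: k f => [|k IH] f sf.
all: pose g := dq f p.
all: have sfp := near_self sf.
all: have sg : \forall z \near p, smooth g z
  by apply: filterS sf => z sz; exact: smooth_dq.
all: have E : \forall z \near p, derive1 f z = g z + (z - p) * derive1 g z.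
1,3: apply: filterS sg => z sgz.
1,2: have -> : f = (fun z => f p + (z - p) * g z) by apply/funext => v; exact: dqE.
1,2: have r1 : reg 1 (fun z => z - p) z by apply: regB; [exact: reg_id|exact: reg_cst].
1,2: rewrite (derive1D (reg_cst 1 _ _) (regM r1 (sgz 1%N))) derive1C add0r.
1,2: rewrite (derive1M r1 (sgz 1%N)) derive1B; [|exact: reg_id|exact: reg_cst].
1,2: by rewrite derive1_idC derive1C subr0 mul1r.
  have fgp := near_self E; rewrite subrr mul0r addr0 in fgp.
  apply: (@near_cvgC _ (fun z => g z + (z - p) * derive1 g z)).
    by apply: filterS E => z ->.
  apply: continuousDC; first exact: smooth_continuous (near_self sg).
  have /near_disc[d d0 hd] := sg.
  have d2 : 0 < d / 2 by rewrite divr_gt0.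
  have sgd z : nm (z - p) <= d / 2 -> smooth g z by move=> zd; apply: hd; lra.
  have [|M M0 HM] := @disc_bounded _ g p (d / 2) (ltW d2).
    by move=> z /sgd/smooth_continuous.
  have bd z : nm (z - p) <= d / 2 / 2 -> nm (derive1 g z) <= 2 * M / (d / 2 / 2).
    exact: smooth_nm_derive1.
  set B := 2 * M / _ in bd; have d4 : 0 < d / 2 / 2 by rewrite !divr_gt0.
  have B0 : 0 <= B by rewrite /B divr_ge0 ?(ltW d4)// mulr_ge0.
  apply/continuous_disc => e e0; rewrite subrr mul0r.
  exists (Num.min (d / 2 / 2) (e / (B + 1))).
    by rewrite lt_min !divr_gt0// ltr_wpDl.
  move=> z; rewrite lt_min subr0 nmM => /andP[/ltW/bd zB ze].
  apply: (@le_lt_trans _ _ (nm (z - p) * (B + 1))).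
    by rewrite ler_wpM2l ?nm_ge0//; lra.
  by rewrite -ltr_pdivlMr// ltr_wpDl.
exists (fun z => dq g p z + derive1 g z).
  apply: regD; last exact: IH.
  by have := smooth_dq (near_self sg) (near_self sg); exact.
have fgp := near_self E; rewrite subrr mul0r addr0 in fgp.
apply: filterS E => z ->; rewrite fgp {1}(dqE g p z); ring.
Qed.

(** [smooth f p] concerns only quotients based at [p] and says nothing of derivatives at nearby
    points; asking it on a neighbourhood makes the class stable under [derive1]. *)
Definition hol f p := \forall z \near p, smooth f z.

Lemma hol_smooth f p : hol f p -> smooth f p.
Proof. exact: near_self. Qed.

Lemma entire_hol f p : (forall z, smooth f z) -> hol f p.
Proof. by move=> sf; near=> z; exact: sf. Unshelve. all: end_near. Qed.

Lemma hol_eq f g p : (\forall z \near p, f z = g z) -> hol f p -> hol g p.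
Proof.
move=> /near_join fg; apply: filterS2 fg => z fg sf k.
exact: reg_near (fg) (sf k).
Qed.

Lemma hol_derive1 f p : hol f p -> hol (derive1 f) p.
Proof.
move=> /near_join; apply: filterS => z hf k; exact: reg_derive1.
Qed.

Lemma hol_derive1n n f p : hol f p -> hol (derive1n n f) p.
Proof. by move=> hf; elim: n => [//|n IH]; exact: hol_derive1. Qed.

Lemma hol_cst c p : hol (fun=> c) p.
Proof. by apply: entire_hol => z k; exact: reg_cst. Qed.

Lemma hol_id p : hol (fun z => z) p.
Proof. by apply: entire_hol => z k; exact: reg_id. Qed.

Lemma holD f g p : hol f p -> hol g p -> hol (fun z => f z + g z) p.
Proof. by apply: filterS2 => z sf sg k; apply: regD. Qed.

Lemma holM f g p : hol f p -> hol g p -> hol (fun z => f z * g z) p.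
Proof. by apply: filterS2 => z sf sg k; apply: regM. Qed.

Lemma holV f p : f p != 0 -> hol f p -> hol (fun z => (f z)^-1) p.
Proof.
move=> fp0 hf; have := near_neq0 (smooth_continuous (hol_smooth hf)) fp0.
by apply: filterS2 hf => z sf z0 k; apply: regV.
Qed.

Lemma hol_prod (I : Type) (s : seq I) (P : pred I) (F : I -> C -> C) p :
  (forall i, hol (F i) p) -> hol (fun z => \prod_(i <- s | P i) F i z) p.
Proof.
move=> hF; elim: s => [|i s IH].
  by apply: hol_eq (hol_cst 1 p); near=> z; rewrite big_nil.
apply: (@hol_eq (fun z => (if P i then F i z else 1) * \prod_(i <- s | P i) F i z)).
  by near=> z; rewrite big_cons; case: (P i); rewrite ?mul1r.
apply: holM => //; case: (P i) => //; exact: hol_cst.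
Unshelve. all: end_near. Qed.

Lemma hol_sum (I : Type) (s : seq I) (P : pred I) (F : I -> C -> C) p :
  (forall i, hol (F i) p) -> hol (fun z => \sum_(i <- s | P i) F i z) p.
Proof.
move=> hF; elim: s => [|i s IH].
  by apply: hol_eq (hol_cst 0 p); near=> z; rewrite big_nil.
apply: (@hol_eq (fun z => (if P i then F i z else 0) + \sum_(i <- s | P i) F i z)).
  by near=> z; rewrite big_cons; case: (P i); rewrite ?add0r.
apply: holD => //; case: (P i) => //; exact: hol_cst.
Unshelve. all: end_near. Qed.

Lemma hol_comp f g p : hol g (f p) -> hol f p -> hol (fun z => g (f z)) p.
Proof.
move=> hg hf; have cf := smooth_continuous (hol_smooth hf).
by apply: filterS2 (near_comp cf hg) hf => z sg sf k; apply: reg_comp.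
Qed.

Lemma hol_shift f (a p : C) : hol f (p - a) -> hol (fun z => f (z - a)) p.
Proof.
move=> hf; apply: (@hol_comp (fun z => z - a) f p hf).
by apply: holD; [exact: hol_id|exact: hol_cst].
Qed.

Lemma near_shift (P : C -> Prop) (a p : C) : (\forall z \near p - a, P z) ->
  \forall z \near p, P (z - a).
Proof.
move=> H; apply: (@near_comp _ (fun z => z - a) p P) => //.
exact: (@continuous_subC _ a p).
Qed.

End Derivatives.

(** * The complex exponential *)

Section Exponential.
Variable K : realType.
Local Notation C := K[i].
Implicit Types (z w p c : C) (e d r M x y : K) (f g : C -> C).

(** Since [p] is not isolated, the value of a continuous function there is its limit along points
    other than [p]. *)
Lemma continuous_eq g p l : {for p, continuous g} ->
  (forall e, 0 < e -> exists2 d, 0 < d &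
     forall z, z != p -> nm (z - p) < d -> nm (g z - l) <= e) ->
  g p = l.
Proof.
move=> /continuous_disc cg H; apply/eqP; rewrite -subr_eq0; apply/eqP/nm_le0.
apply/ler_addgt0Pr => e e0; rewrite add0r.
have e2 : 0 < e / 2 by rewrite divr_gt0.
have [d d0 hd] := cg _ e2; have [d' d'0 hd'] := H _ e2.
pose t := Num.min d d' / 2; have m0 : 0 < Num.min d d' by rewrite lt_min d0.
have t0 : 0 < t by rewrite divr_gt0.
have td : t < d.
  by have : Num.min d d' <= d; [rewrite ge_min lexx|rewrite /t; lra].
have td' : t < d'.
  by have : Num.min d d' <= d'; [rewrite ge_min lexx orbT|rewrite /t; lra].
have nt : nm (p + t%:C - p) = t by rewrite addrAC subrr add0r nm_real gtr0_norm.
have tp : p + t%:C != p by rewrite -subr_eq0 -nm_gt0 nt.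
have h1 := hd (p + t%:C); have h2 := hd' (p + t%:C) tp; rewrite nt in h1 h2.
have {}h1 := h1 td; have {}h2 := h2 td'.
have := nmD (g p - g (p + t%:C)) (g (p + t%:C) - l).
by rewrite addrA subrK (nmC (g p)); lra.
Qed.

Lemma continuous_eq_punctured f g p : {for p, continuous f} ->
  {for p, continuous g} -> (\forall z \near p, z != p -> f z = g z) ->
  f p = g p.
Proof.
move=> cf cg /near_disc[d d0 hd]; apply/eqP; rewrite -subr_eq0; apply/eqP.
apply: (@continuous_eq (fun z => f z - g z)).
  exact: (continuousB cf cg).
move=> e e0; exists d => // z zp zd.
by rewrite hd// subrr subr0 nm0 ltW.
Qed.

Lemma is_derive_small (h : K -> K) (dh : K) : is_derive (0 : K) 1 h dh ->
  forall e, 0 < e -> exists2 d, 0 < d &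
    forall x, `|x| < d -> `|h x - h 0 - dh * x| <= e * `|x|.
Proof.
move=> [dv <-] e e0; move: dv; rewrite /derivable /derive.
move=> /cvgrPdistC_lt H; have := H e e0.
rewrite near_withinE => /nbhs_normP[d /= d0 hd]; exists d => // x xd.
have [->|x0] := eqVneq x 0; first by rewrite subrr mulr0 subrr !normr0 mulr0.
have := hd x; rewrite /= sub0r normrN => /(_ xd x0).
rewrite addr0 [x%:A]mulr1 => /ltW {}H.
rewrite -ler_pdivrMr ?normr_gt0// -normfV -normrM.
apply: le_trans H; rewrite le_eqVlt; apply/orP; left; apply/eqP; congr `|_|.
rewrite mulrBl mulfK// mulrC; congr (_ - _).
Qed.

Lemma nm_cexp z : nm (cexp z) = expR (complex.Re z).
Proof.
case: z => x y; rewrite /cexp /nm normc_def /= !exprMn -mulrDr cos2Dsin2 mulr1.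
by rewrite sqrtr_sqr ger0_norm ?expR_ge0.
Qed.

Lemma cexpD z w : cexp (z + w) = cexp z * cexp w.
Proof.
case: z w => [a b] [c d]; rewrite /cexp /= expRD cosD sinD.
apply/eqP; rewrite eq_complex /=; apply/andP; split; apply/eqP; ring.
Qed.

Lemma cexp0 : cexp 0 = 1 :> C.
Proof. by rewrite /cexp /= expR0 cos0 sin0 mulr1 mulr0. Qed.

Lemma cexp_neq0 z : cexp z != 0.
Proof. by rewrite -nm_gt0 nm_cexp expR_gt0. Qed.

Lemma cexpN z : cexp (- z) = (cexp z)^-1.
Proof.
by apply: (mulIf (cexp_neq0 z)); rewrite mulVf ?cexp_neq0// -cexpD addNr cexp0.
Qed.

Lemma cexpX z n : cexp (z *+ n) = cexp z ^+ n.
Proof.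
by elim: n => [|n IH]; rewrite ?mulr0n ?cexp0// mulrS cexpD IH exprS.
Qed.

Lemma cexp_sum (I : Type) (s : seq I) (P : pred I) (F : I -> C) :
  cexp (\sum_(i <- s | P i) F i) = \prod_(i <- s | P i) cexp (F i).
Proof. by apply: (big_morph (@cexp K)); [exact: cexpD|exact: cexp0]. Qed.

(** The first-order expansions of the real functions exp, cos and sin at 0 are combined; they are
    all that is borrowed from real analysis about the derivative of [cexp]. *)
Lemma cexp_small e : 0 < e -> exists2 d, 0 < d &
  forall w, nm w < d -> nm (cexp w - 1 - w) <= e * nm w.
Proof.
(* The four error terms at the end are at most 1, 2, 2 and 2 times [q * n], whence 7. The minimum
   with 1 makes [n] small enough for [expR x <= 2]. *)
move=> e0; have e6 : 0 < Num.min e 1 / 7 by rewrite divr_gt0// lt_min e0 ltr01.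
have [d1 d10 h1] := is_derive_small (is_derive_expR (0 : K)) e6.
have [d2 d20 h2] := is_derive_small (is_derive_cos (0 : K)) e6.
have [d3 d30 h3] := is_derive_small (is_derive_sin (0 : K)) e6.
set q := _ / 7 in e6 h1 h2 h3.
have q1 : q <= 1 / 7 by rewrite /q ler_pdivrMr// divfK// ge_min lexx orbT.
have qe : q <= e / 7 by rewrite /q ler_pM2r ?invr_gt0// ge_min lexx.
exists (Num.min (Num.min d1 d2) (Num.min d3 q)).
  by rewrite !lt_min d10 d20 d30 e6.
case=> x y; rewrite !lt_min => /andP[/andP[w1 w2] /andP[w3 wq]].
have xw := @nm_Re _ (x +i* y); have yw := @nm_Im _ (x +i* y).
set n := nm _ in w1 w2 w3 wq xw yw *; rewrite /= in xw yw.
have {}h1 := h1 x (le_lt_trans xw w1).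
have {}h2 := h2 y (le_lt_trans yw w2).
have {}h3 := h3 y (le_lt_trans yw w3).
rewrite expR0 mul1r in h1; rewrite cos0 sin0 oppr0 mul0r subr0 in h2.
rewrite sin0 cos0 subr0 mul1r in h3.
have n0 : 0 <= n by exact: nm_ge0.
have H1 : `|expR x - 1 - x| <= q * n by rewrite (le_trans h1)// ler_wpM2l// ltW.
have H2 : `|cos y - 1| <= q * n by rewrite (le_trans h2)// ler_wpM2l// ltW.
have H3 : `|sin y - y| <= q * n by rewrite (le_trans h3)// ler_wpM2l// ltW.
have H4 : `|expR x - 1| <= 2 * n.
  have := ler_normD (expR x - 1 - x) x; rewrite subrK; nra.
have H5 : `|expR x| <= 2.
  have := ler_normD (expR x - 1) 1; rewrite subrK normr1; nra.
rewrite /cexp /=; apply: le_trans (nm_ReIm _) _; rewrite /=.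
have -> : expR x * cos y - 1 - x = (expR x - 1 - x) + expR x * (cos y - 1) by ring.
have -> : expR x * sin y - 0 - y = expR x * (sin y - y) + (expR x - 1) * y by ring.
have := ler_normD (expR x - 1 - x) (expR x * (cos y - 1)).
have := ler_normD (expR x * (sin y - y)) ((expR x - 1) * y).
rewrite !normrM.
have : `|expR x| * `|cos y - 1| <= 2 * (q * n) by rewrite ler_pM.
have : `|expR x| * `|sin y - y| <= 2 * (q * n) by rewrite ler_pM.
have : `|expR x - 1| * `|y| <= 2 * n * q by rewrite ler_pM// ?(le_trans yw)// ltW.
have : q * n <= e / 7 * n by rewrite ler_wpM2r.
lra.
Qed.

Lemma regX k n f p : reg k f p -> reg k (fun z => f z ^+ n) p.
Proof.
move=> rf; elim: n => [|n IH].
  by apply: reg_near (reg_cst k 1 p); near=> z; rewrite expr0.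
by apply: reg_near (regM rf IH); near=> z; rewrite exprS.
Unshelve. all: end_near. Qed.

Lemma nm_subrX (a b : C) r n : 1 <= r -> nm a <= r -> nm b <= r ->
  nm (a ^+ n.+1 - b ^+ n.+1) <= nm (a - b) * (n.+1%:R * r ^+ n.+1).
Proof.
move=> r1 ar br; rewrite subrXX nmM ler_wpM2l ?nm_ge0//.
have r0 : 0 <= r by exact: le_trans r1.
have H (m : nat) (F : nat -> C) : (forall i, (i < m)%N -> nm (F i) <= r ^+ n.+1) ->
    nm (\sum_(i < m) F i) <= m%:R * r ^+ n.+1.
  elim: m F => [|m IH] F HF; first by rewrite big_ord0 nm0 mul0r.
  rewrite big_ord_recr /= (le_trans (nmD _ _))// -natr1 mulrDl mul1r lerD ?HF//.
  by apply: IH => i im; apply: HF; exact: ltnW.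
apply: (H _ (fun i => a ^+ (n.+1.-1 - i) * b ^+ i)) => i /= im.
rewrite nmM !nmX (le_trans (y := r ^+ (n - i) * r ^+ i))//.
  by rewrite ler_pM ?exprn_ge0 ?nm_ge0// lerXn2r ?nnegrE ?nm_ge0.
by rewrite -exprD subnK// ler_weXn2l.
Qed.

(* Only [cexp w = 1 + w + o(w)] is known at this stage; uniformity comes from
   [cexp z = cexp (z / n) ^+ n]. *)
Lemma ucvg_cexp :
  ucvg (fun n z => (1 + z * n.+1%:R^-1) ^+ n.+1) (@cexp K).
Proof.
move=> r0 e e0; pose r := `|r0|; have rr0 : 0 <= r by exact: normr_ge0.
have re0 : 0 < r * expR r + 1 by rewrite ltr_wpDl// mulr_ge0// expR_ge0.
(* One factor errs by [e' * r / n.+1]; telescoping the powers multiplies this by [n.+1 * expR r], so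
   the total error is [e' * (r * expR r)]. *)
pose e' := e / (r * expR r + 1); have e'0 : 0 < e' by rewrite divr_gt0.
have [d d0 hd] := cexp_small e'0.
exists (Num.bound (r / d)) => n Nn z zr0.
have zr : nm z <= r by rewrite (le_trans zr0)// ler_norm.
have n0 : 0 < n.+1%:R :> K by rewrite ltr0n.
have nmz : nm (z * n.+1%:R^-1) = nm z / n.+1%:R by rewrite nmM nmV nm_nat.
have zn : nm z / n.+1%:R <= r / n.+1%:R by rewrite ler_pM2r ?invr_gt0.
have rn : r / n.+1%:R < d.
  rewrite ltr_pdivrMr// mulrC -ltr_pdivrMr//.
  have := archi_boundP (divr_ge0 rr0 (ltW d0)).
  move=> /lt_le_trans; apply; rewrite ler_nat; exact: leqW.
have -> : cexp z = cexp (z * n.+1%:R^-1) ^+ n.+1.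
  by rewrite -cexpX -mulrnAr -[in X in _ * X]mulr_natr mulVf ?mulr1// pnatr_eq0.
have E1 : 1 <= expR (r / n.+1%:R) by rewrite -expR0 ler_expR divr_ge0// ltW.
have small := hd (z * n.+1%:R^-1); rewrite nmz in small.
have {}small := small (le_lt_trans zn rn).
have a1 : nm (1 + z * n.+1%:R^-1) <= expR (r / n.+1%:R).
  rewrite (le_trans (nmD _ _))// nm1 nmz (le_trans _ (expR_ge1Dx _))//.
  by rewrite lerD2l.
have b1 : nm (cexp (z * n.+1%:R^-1)) <= expR (r / n.+1%:R).
  rewrite nm_cexp ler_expR (le_trans _ zn)// -nmz.
  by rewrite (le_trans (ler_norm _))// nm_Re.
apply: le_trans (nm_subrX n E1 a1 b1) _.
rewrite -expRM_natl [_ * (r / _)]mulrC. rewrite (divfK (lt0r_neq0 n0)).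
rewrite nmC opprD addrA.
apply: (@le_trans _ _ (e' * (r / n.+1%:R) * (n.+1%:R * expR r))).
  rewrite ler_wpM2r ?mulr_ge0 ?expR_ge0//.
  by rewrite (le_trans small)// ler_wpM2l// ltW.
have -> : e' * (r / n.+1%:R) * (n.+1%:R * expR r) = e' * (r * expR r).
  by field; rewrite nat1r pnatr_eq0.
rewrite /e' mulrAC ler_pdivrMr// ler_wpM2l ?ltW//; lra.
Qed.

Lemma smooth_cexp z : smooth (@cexp K) z.
Proof.
apply: smooth_lim ucvg_cexp _ => n w k; apply: regX.
by apply: regD; [exact: reg_cst|apply: regM; [exact: reg_id|exact: reg_cst]].
Qed.

Lemma derive1_cexp z : derive1 (@cexp K) z = cexp z.
Proof.
have d0 : derive1 (@cexp K) 0 = 1.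
  rewrite -dq_id; apply: continuous_eq.
    by apply: cdq; exact: smooth_cexp.
  move=> e /cexp_small[d d0 hd]; exists d => // w w0; rewrite subr0 => /hd H.
  rewrite /dq (negPf w0) subr0 cexp0 -(@ler_pM2r _ (nm w)) ?nm_gt0//.
  by rewrite -nmM mulrBl divfK// mul1r.
pose f (w : C) := w - z.
have -> : @cexp K = (fun w => cexp z * cexp (f w)).
  by apply/funext => w; rewrite -cexpD addrC subrK.
have r1 : reg 1 f z by apply: regB; [exact: reg_id|exact: reg_cst].
have r2 : reg 1 (@cexp K) (f z) by exact: smooth_cexp.
rewrite (derive1Z _ (reg_comp r2 r1)) (derive1_chain r2 r1).
rewrite (derive1B (reg_id 1 z) (reg_cst 1 z z)) derive1_idC derive1C subr0 mulr1.
by rewrite /f subrr d0 mulr1 cexp0 mulr1.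
Qed.

End Exponential.

(** * Weierstrass factors and products *)

Section PrimaryFactor.
Variable K : realType.
Local Notation C := K[i].
Implicit Types (z w p c t : C) (e d r M x y : K) (f g : C -> C).

(** The primary factor of genus two in the single variable [t = u / w], so that one estimate near 0
    serves every lattice point. *)
Definition efac t : C := (1 - t) * cexp (t + t ^+ 2 / 2).

Lemma wfactorE u w : wfactor u w = efac (u / w).
Proof.
rewrite /wfactor /efac; congr (_ * cexp (_ + _)).
by rewrite expr_div_n invfM mulrA mulrAC.
Qed.

Lemma smooth_efac t : smooth efac t.
Proof.
move=> k; apply: regM.
  by apply: regB; [exact: reg_cst|exact: reg_id].
apply: reg_comp; first exact: smooth_cexp.
apply: regD; first exact: reg_id.
by apply: regM; [apply: regX; exact: reg_id|exact: reg_cst].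
Qed.

Lemma derive1_efac t : derive1 efac t = - t ^+ 2 * cexp (t + t ^+ 2 / 2).
Proof.
pose h z : C := z + 2^-1 * (z * z).
have -> : efac = (fun z => (1 - z) * cexp (h z)).
  by apply/funext => z; rewrite /efac /h expr2 [_ / 2]mulrC.
have r1 := reg_cst 1 (1 : C) t; have rt := reg_id 1 t.
have rh : reg 1 h t by apply: (regD rt (regM (reg_cst 1 _ t) (regM rt rt))).
have rc : reg 1 (@cexp K) (h t) by exact: smooth_cexp.
rewrite (derive1M (regB r1 rt) (reg_comp rc rh)).
rewrite (derive1B r1 rt) derive1C derive1_idC (derive1_chain rc rh) derive1_cexp.
have -> : derive1 h t = 1 + t.
  rewrite /h (derive1D rt (regM (reg_cst 1 _ t) (regM rt rt))) (derive1Z _ (regM rt rt)).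
  by rewrite (derive1M rt rt) !derive1_idC; field.
by rewrite /h expr2 [_ / 2]mulrC; ring.
Qed.

(* The cubic vanishing is read off [efac'(t) = - t^2 exp(t + t^2/2)]. *)
Lemma efac_cubic : exists2 g : C -> C, forall t, smooth g t &
  forall t, efac t = 1 + t ^+ 3 * g t.
Proof.
have sE := smooth_efac.
pose g1 := dq efac 0; have s1 t : smooth g1 t by exact: smooth_dq.
pose g2 := dq g1 0; have s2 t : smooth g2 t by exact: smooth_dq.
have g10 : g1 0 = 0 by rewrite /g1 dq_id derive1_efac expr0n /= oppr0 mul0r.
have E0 : efac 0 = 1 by rewrite /efac subr0 mul1r add0r expr0n /= mul0r cexp0.
have E2 t : efac t = 1 + t * t * g2 t.
  by rewrite (dqE efac 0) -/g1 (dqE g1 0) -/g2 g10 E0 !subr0 add0r mulrA.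
have g20 : g2 0 = 0.
  (* Derivative of [efac = 1 + t^2 g2], divided by [t]. Both sides are continuous at 0, where the
     identity becomes [2 * g2 0 = 0]. *)
  have H t : t != 0 -> g2 t + g2 t + t * derive1 g2 t = - t * cexp (t + t ^+ 2 / 2).
    move=> t0; apply: (mulfI t0).
    have rt := reg_id 1 t; have r2 := s2 t 1%N.
    have -> : t * (- t * cexp (t + t ^+ 2 / 2)) = derive1 efac t.
      by rewrite derive1_efac; ring.
    have -> : efac = (fun t => 1 + t * t * g2 t) by apply/funext.
    rewrite (derive1D (reg_cst 1 _ t) (regM (regM rt rt) r2)) derive1C.
    by rewrite (derive1M (regM rt rt) r2) (derive1M rt rt) derive1_idC; ring.
  pose h z : C := z + z ^+ 2 / 2.
  have rh : reg 0 h 0.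
    apply: (@regD _ 0%N (fun z => z)); first exact: (reg_id 0).
    apply: (@regM _ 0%N (fun z => z ^+ 2)); last exact: (reg_cst 0).
    by apply: (@regX _ 0%N 2 (fun z => z)); exact: (reg_id 0).
  have rd : reg 0 (derive1 g2) 0.
    by apply: hol_smooth; apply: hol_derive1; exact: entire_hol.
  have := @continuous_eq_punctured _ (fun t => g2 t + g2 t + t * derive1 g2 t)
    (fun t => - t * cexp (t + t ^+ 2 / 2)) 0.
  rewrite oppr0 !mul0r addr0 => /(_ _ _ _)/eqP.
  rewrite -mulr2n mulrn_eq0 /= => H'; apply/eqP; apply: H'.
  - exact: (@regD _ 0%N _ _ 0 (regD (s2 0 0%N) (s2 0 0%N)) (regM (reg_id 0 0) rd)).
  - exact: (@regM _ 0%N _ _ 0 (regN (reg_id 0 0)) (reg_comp (smooth_cexp (h 0) 0%N) rh)).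
  - by near=> t; exact: H.
exists (dq g2 0); first by move=> t; exact: smooth_dq.
by move=> t; rewrite E2 (dqE g2 0) g20 subr0; ring.
Unshelve. all: end_near. Qed.

Lemma efac_bound : exists2 B : K, 0 <= B &
  forall t, nm t <= 1 -> nm (efac t - 1) <= B * nm t ^+ 3.
Proof.
have [g sg Eg] := efac_cubic.
have [|B B0 HB] := @disc_bounded _ g 0 1 ler01.
  by move=> z _; exact: smooth_continuous.
exists B => // t t1; rewrite Eg addrAC subrr add0r nmM nmX mulrC.
by rewrite ler_wpM2r ?exprn_ge0 ?nm_ge0// HB ?subr0.
Qed.

Lemma efac_neq0 t : t != 1 -> efac t != 0.
Proof. by move=> t1; rewrite mulf_neq0 ?cexp_neq0// subr_eq0 eq_sym. Qed.

(** As long as the accumulated error is at most 1, the cross term [(F i - 1) * (P - 1)] is at most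
    [d]; hence each factor adds at most [2 * d]. *)
Lemma nm_prod_sub1 (I : eqType) (s : seq I) (F : I -> C) d : 0 <= d ->
  (forall i, i \in s -> nm (F i - 1) <= d) ->
  (size s)%:R * (2 * d) <= 1 ->
  nm (\prod_(i <- s) F i - 1) <= (size s)%:R * (2 * d).
Proof.
move=> d0; elim: s => [|i s IH] HF sd.
  by rewrite big_nil subrr nm0 mul0r.
rewrite big_cons /= -natr1 mulrDl mul1r in sd *.
have h1 : nm (F i - 1) <= d by apply: HF; rewrite mem_head.
have h2 : nm (\prod_(i <- s) F i - 1) <= (size s)%:R * (2 * d).
  by apply: IH; [move=> j js; apply: HF; rewrite inE js orbT|lra].
set P := \prod_(i <- s) _ in h2 *; set k := _ * (2 * d) in sd h2 *.
have -> : F i * P - 1 = (F i - 1) * (P - 1) + (P - 1) + (F i - 1) by ring.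
have := nmD ((F i - 1) * (P - 1) + (P - 1)) (F i - 1).
have := nmD ((F i - 1) * (P - 1)) (P - 1); rewrite nmM.
have : nm (F i - 1) * nm (P - 1) <= d * k by rewrite ler_pM ?nm_ge0.
have : d * k <= d * 1 by rewrite ler_wpM2l//; lra.
lra.
Qed.

(** Supplies the telescoping majorant of [1 / n.+1 ^ 2] with which the products are estimated
    without summing a series. *)
Lemma invnB n : (0 < n)%N ->
  n%:R^-1 - n.+1%:R^-1 = (n%:R * n.+1%:R)^-1 :> K.
Proof.
move=> n0; have x0 : n%:R != 0 :> K by rewrite pnatr_eq0 -lt0n.
have : n.+1%:R != 0 :> K by rewrite pnatr_eq0.
rewrite -natr1; move: (n%:R : K) x0 => x x0 x1; field.
by rewrite x0 x1.
Qed.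

(** Each [r n] is at most the exponential of [A (1/n - 1/(n+1))]; the exponents telescope to at most
    [A / N0 <= A]. *)
Lemma prod_growth (p r : nat -> C) (A : K) N0 : 0 <= A -> (0 < N0)%N ->
  (forall n, (N0 <= n)%N -> p n.+1 = p n * r n) ->
  (forall n, (N0 <= n)%N -> nm (r n - 1) <= A / n.+1%:R ^+ 2) ->
  forall n, (N0 <= n)%N -> nm (p n) <= nm (p N0) * expR A.
Proof.
move=> A0 N00 Hp Hr n Nn; pose b m : K := A * (N0%:R^-1 - m%:R^-1).
have nz m : (N0 <= m)%N -> 0 < m%:R :> K.
  by move=> h; rewrite ltr0n; exact: leq_trans h.
have H : nm (p n) <= nm (p N0) * expR (b n).
  elim: n Nn => [|n IH]; first by rewrite leqn0 => /eqP h; rewrite h in N00.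
  rewrite leq_eqVlt => /orP[/eqP <-|]; first by rewrite /b subrr mulr0 expR0 mulr1.
  rewrite ltnS => Nn; rewrite Hp// nmM.
  have h1 : nm (r n) <= expR (A * (n%:R^-1 - n.+1%:R^-1)).
    apply: le_trans (expR_ge1Dx _).
    have := nmD (r n - 1) 1; rewrite subrK nm1 => /le_trans; apply.
    rewrite addrC lerD2l (le_trans (Hr n Nn))// ler_wpM2l//.
    rewrite invnB; last by rewrite -(ltr0n K) nz.
    rewrite lef_pV2 ?posrE ?exprn_gt0 ?mulr_gt0 ?nz ?leqW//.
    by rewrite expr2 ler_wpM2r ?ler0n// ler_nat.
  have -> : b n.+1 = b n + A * (n%:R^-1 - n.+1%:R^-1) by rewrite /b; ring.
  by rewrite expRD mulrA ler_pM ?nm_ge0// IH.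
apply: le_trans H _; rewrite ler_wpM2l ?nm_ge0// ler_expR /b ler_piMr//.
have : N0%:R^-1 <= 1 :> K by rewrite invf_le1 ?nz// ler1n.
have : 0 <= n%:R^-1 :> K by rewrite invr_ge0.
lra.
Qed.

(** The increment [p n * (r n - 1)] is bounded by the growth estimate times a telescoping
    difference. The factor [nm (p N0)] is kept because a relative error is what later excludes a
    zero limit. *)
Lemma prod_cauchy (p r : nat -> C) (A : K) N0 : 0 <= A -> (0 < N0)%N ->
  (forall n, (N0 <= n)%N -> p n.+1 = p n * r n) ->
  (forall n, (N0 <= n)%N -> nm (r n - 1) <= A / n.+1%:R ^+ 2) ->
  forall m n, (N0 <= m)%N -> (m <= n)%N ->
    nm (p n - p m) <= nm (p N0) * expR A * A * (m%:R^-1 - n%:R^-1).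
Proof.
move=> A0 N00 Hp Hr m n Nm; set B := nm (p N0) * expR A.
have nz k : (N0 <= k)%N -> 0 < k%:R :> K.
  by move=> h; rewrite ltr0n; exact: leq_trans h.
have B0 : 0 <= B by rewrite mulr_ge0 ?nm_ge0 ?expR_ge0.
elim: n => [|n IH].
  by rewrite leqn0 => /eqP m0; move: Nm; rewrite m0 leqn0 => /eqP h; rewrite h in N00.
rewrite leq_eqVlt => /orP[/eqP <-|]; first by rewrite !subrr mulr0 nm0.
rewrite ltnS => mn; have Nn := leq_trans Nm mn.
have -> : p n.+1 - p m = p n * (r n - 1) + (p n - p m) by rewrite Hp//; ring.
apply: le_trans (nmD _ _) _; rewrite nmM.
have -> : B * A * (m%:R^-1 - n.+1%:R^-1) =
   B * (A * (n%:R^-1 - n.+1%:R^-1)) + B * A * (m%:R^-1 - n%:R^-1) by ring.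
rewrite lerD ?IH// ler_pM ?nm_ge0//; first exact: prod_growth Hp Hr _ Nn.
rewrite (le_trans (Hr n Nn))// ler_wpM2l//.
rewrite invnB; last by rewrite -(ltr0n K) nz.
rewrite lef_pV2 ?posrE ?exprn_gt0 ?mulr_gt0 ?nz ?leqW//.
by rewrite expr2 ler_wpM2r ?ler0n// ler_nat.
Qed.

End PrimaryFactor.

(** * The sigma function *)

Section Grid.

Definition zs (N : nat) : seq int := [seq i%:Z - N%:Z | i <- iota 0 N.*2.+1].

Definition sq (N : nat) : seq (int * int) := [seq (m, n) | m <- zs N, n <- zs N].

Arguments zs : simpl never.
Arguments sq : simpl never.

Lemma mem_zs N m : (m \in zs N) = (`|m| <= N)%N.
Proof.
apply/mapP/idP => [ [k]|mN]; first by rewrite mem_iota => iN ->; lia.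
by exists `|(m + N%:Z)%R|%N; [rewrite mem_iota|]; lia.
Qed.

Lemma zs_uniq N : uniq (zs N).
Proof. by rewrite map_inj_uniq ?iota_uniq// => i j; lia. Qed.

Lemma size_zs N : size (zs N) = N.*2.+1.
Proof. by rewrite size_map size_iota. Qed.

Lemma mem_sq N p : (p \in sq N) = (`|p.1| <= N)%N && (`|p.2| <= N)%N.
Proof.
rewrite -!mem_zs; case: p => m n; apply/allpairsP/andP => /=.
  by move=> [ [m' n'] /= [hm hn [-> ->]]].
by move=> [hm hn]; exists (m, n).
Qed.

Lemma sq_uniq N : uniq (sq N).
Proof.
by rewrite allpairs_uniq ?zs_uniq// => -[a b] [a' b'] _ _ /= [-> ->].
Qed.

Definition ring_of (N : nat) : seq (int * int) :=
  [seq p <- sq N.+1 | p \notin sq N].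

(** Linear growth of the rings against cubic smallness of each factor gives ring products of the
    form 1 + O(1/N^2). *)
Lemma size_ring N : size (ring_of N) = (8 * N.+1)%N.
Proof.
have sub : {subset sq N <= sq N.+1}.
  by move=> p; rewrite !mem_sq => /andP[h1 h2]; rewrite !leqW.
have e1 : size (sq N.+1) = (size [seq p <- sq N.+1 | p \in sq N] + size (ring_of N))%N.
  by rewrite /ring_of !size_filter count_predC.
have e2 : size [seq p <- sq N.+1 | p \in sq N] = size (sq N).
  apply/perm_size/uniq_perm; rewrite ?filter_uniq ?sq_uniq// => p.
  rewrite mem_filter; case pN : (p \in sq N) => //=; exact: sub.
move: e1; rewrite e2 /sq !size_allpairs !size_zs; lia.
Qed.

Lemma big_sqS (R : comNzRingType) (F : int * int -> R) (P : pred (int * int)) N :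
  (forall p, p \in ring_of N -> P p) ->
  \prod_(p <- sq N.+1 | P p) F p =
  (\prod_(p <- sq N | P p) F p) * \prod_(p <- ring_of N) F p.
Proof.
move=> HP; rewrite (bigID (fun p => p \in sq N)) /=; congr (_ * _).
  rewrite -big_filter -[RHS]big_filter; apply/perm_big/uniq_perm.
  - by rewrite filter_uniq ?sq_uniq.
  - by rewrite filter_uniq ?sq_uniq.
  move=> p; rewrite !mem_filter; case: (P p) => //=.
  case pN : (p \in sq N) => //=; move: pN.
  by rewrite !mem_sq => /andP[h1 h2]; rewrite !leqW.
rewrite -big_filter -[RHS]big_filter; apply/perm_big/uniq_perm.
- by rewrite filter_uniq ?sq_uniq.
- by rewrite filter_predT filter_uniq ?sq_uniq.
move=> p; rewrite filter_predT !mem_filter; apply/andP/andP.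
  by move=> [/andP[_ h] h'].
move=> h; have pr : p \in ring_of N by rewrite mem_filter; apply/andP.
by case: h => h ->; rewrite h HP.
Qed.

End Grid.

(** * Convergence, smoothness and zeros of sigma *)

Section Sigma.
Variable K : realType.
Local Notation C := K[i].
Implicit Types (z w u v t : C) (c e d r M x y : K) (f g : C -> C).

(** Bounding both indices makes every lattice point indexed outside the square [sq N] at least
    [c * N.+1] in modulus. *)
Definition gap (w1 w2 : C) c := forall m n : int,
  c * (`|m|%N)%:R <= nm (latt w1 w2 m n) /\ c * (`|n|%N)%:R <= nm (latt w1 w2 m n).

(** Sigma with its zero at the origin divided out; the limit has value 1 at 0, which gives the
    derivative of sigma there and isolates this zero. *)
Definition tau_part (w1 w2 : C) (N : nat) u : C :=
  \prod_(p <- sq N | p != (0, 0)) wfactor u (latt w1 w2 p.1 p.2).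

Lemma sigma_partE w1 w2 u N : sigma_part w1 w2 u N = u * tau_part w1 w2 N u.
Proof.
rewrite /sigma_part /tau_part; congr (_ * _); apply/esym.
have E : iota 0 N.*2.+1 = index_iota 0 N.*2.+1 by rewrite /index_iota subn0.
rewrite [LHS]big_mkcond /sq big_allpairs_dep /= {1}/zs big_map E big_mkord.
apply: eq_bigr => i _; rewrite {1}/zs big_map E big_mkord.
apply: eq_bigr => j _; rewrite xpair_eqE !subr_eq0 !eqz_nat.
by case: (_ && _).
Qed.

Variables (w1 w2 : C) (c : K).
Hypothesis c0 : 0 < c.
Hypothesis cgap : gap w1 w2 c.

Local Notation lat := (latt w1 w2).

Lemma lattD m n m' n' : lat (m + m') (n + n') = lat m n + lat m' n'.
Proof. by rewrite /latt !rmorphD /=; ring. Qed.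

Lemma lattN m n : lat (- m) (- n) = - lat m n.
Proof. by rewrite /latt !rmorphN /=; ring. Qed.

Lemma latt00 : lat 0 0 = 0.
Proof. by rewrite /latt; ring. Qed.

Lemma latt_ge (p : int * int) N : p \notin sq N ->
  c * N.+1%:R <= nm (lat p.1 p.2).
Proof.
rewrite mem_sq negb_and -!ltnNge => /orP[] h.
  by apply: le_trans (proj1 (cgap _ _)); rewrite ler_pM2l// ler_nat.
by apply: le_trans (proj2 (cgap _ _)); rewrite ler_pM2l// ler_nat.
Qed.

Lemma latt_neq0 (p : int * int) : p != (0, 0) -> lat p.1 p.2 != 0.
Proof.
move=> p0; rewrite -nm_gt0; apply: lt_le_trans (@latt_ge p 0 _).
  by rewrite mulr1.
by apply: contra p0; rewrite mem_sq !leqn0 !absz_eq0 -xpair_eqE; case: (p).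
Qed.

Lemma smooth_prod (I : Type) (s : seq I) (P : pred I) (F : I -> C -> C) z :
  (forall i v, smooth (F i) v) -> smooth (fun v => \prod_(i <- s | P i) F i v) z.
Proof. by move=> sF; apply: hol_smooth; apply: hol_prod => i; exact: entire_hol. Qed.

Lemma smooth_wfactor w u : smooth (fun v => wfactor v w) u.
Proof.
have -> : (fun v => wfactor v w) = (fun v : C => efac (v / w)).
  by apply/funext => v; rewrite wfactorE.
move=> k; apply: (reg_comp (@smooth_efac K _ k)).
by apply: regM; [exact: reg_id|exact: reg_cst].
Qed.

Lemma smooth_tau_part N u : smooth (tau_part w1 w2 N) u.
Proof. by apply: smooth_prod => i v; exact: smooth_wfactor. Qed.

Lemma tau_partS N u : tau_part w1 w2 N.+1 u =
  tau_part w1 w2 N u * \prod_(p <- ring_of N) wfactor u (lat p.1 p.2).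
Proof.
apply: big_sqS => p; rewrite mem_filter => /andP[pN _].
by apply: contra pN => /eqP ->; rewrite mem_sq.
Qed.

Lemma ring_factor R : exists A N0, [/\ 0 <= A, (0 < N0)%N & forall N u,
  (N0 <= N)%N -> nm u <= R ->
  nm (\prod_(p <- ring_of N) wfactor u (lat p.1 p.2) - 1) <= A / N.+1%:R ^+ 2].
Proof.
have [B B0 HB] := efac_bound K.
pose S := `|R| / c; have S0 : 0 <= S by rewrite divr_ge0// ltW.
(* 16 is 8, from the size of a ring, times the 2 of [nm_prod_sub1]. *)
pose A := 16 * (B * S ^+ 3); have A0 : 0 <= A by do 2!apply: mulr_ge0 => //; exact: exprn_ge0.
(* The bound from [S] puts [u / w] in the unit disc, as [efac_bound] requires; the bound from [A]
   keeps the accumulated error at most 1. *)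
exists A, (maxn 1 (maxn (Num.bound A) (Num.bound S))).
split => //; first by rewrite leq_max.
move=> N u; rewrite !geq_max => /and3P[N1 NA NS] uR.
have n0 : 0 < N.+1%:R :> K by rewrite ltr0n.
have AN : A <= N.+1%:R.
  by rewrite ltW// (lt_le_trans (archi_boundP A0))// ler_nat leqW.
have SN : S <= N.+1%:R.
  by rewrite ltW// (lt_le_trans (archi_boundP S0))// ler_nat leqW.
have n1 : 1 <= N.+1%:R :> K by rewrite ler1n.
pose d := B * (S / N.+1%:R) ^+ 3.
have d0 : 0 <= d by rewrite mulr_ge0// exprn_ge0// divr_ge0// ltW.
have E : (size (ring_of N))%:R * (2 * d) = A / N.+1%:R ^+ 2.
  by rewrite size_ring natrM /A /d; field; rewrite nat1r pnatr_eq0.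
rewrite -E; apply: nm_prod_sub1 => //.
  move=> p; rewrite mem_filter => /andP[pN _]; rewrite wfactorE.
  have H : nm (u / lat p.1 p.2) <= S / N.+1%:R.
    have l := latt_ge pN; have cN : 0 < c * N.+1%:R by rewrite mulr_gt0.
    rewrite nmM nmV /S -mulrA -invfM ler_pM ?nm_ge0 ?invr_ge0 ?nm_ge0//.
      by rewrite (le_trans uR)// ler_norm.
    by rewrite lef_pV2 ?posrE//; exact: lt_le_trans l.
  have H1 : nm (u / lat p.1 p.2) <= 1.
    by rewrite (le_trans H)// ler_pdivrMr// mul1r.
  apply: le_trans (HB _ H1) _; rewrite /d ler_wpM2l// lerXn2r// nnegrE ?nm_ge0//.
  by rewrite divr_ge0// ltW.
rewrite E ler_pdivrMr ?exprn_gt0// mul1r expr2 (le_trans AN)// ler_peMr// ltW.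
Qed.

Lemma tau_ucauchy : ucauchy (tau_part w1 w2).
Proof.
move=> R e e0; have [A [N0 [A0 N00 HA]]] := ring_factor `|R|.
have [|M M0 HM] := @disc_bounded _ (tau_part w1 w2 N0) 0 `|R| (normr_ge0 _).
  by move=> z _; exact/smooth_continuous/smooth_tau_part.
pose Q := M * expR A * A / e.
have Q0 : 0 <= Q by rewrite divr_ge0 ?mulr_ge0 ?expR_ge0// ltW.
have key n m u : (maxn N0 (Num.bound Q) <= m)%N -> (m <= n)%N -> nm u <= R ->
    nm (tau_part w1 w2 n u - tau_part w1 w2 m u) <= e.
  rewrite geq_max => /andP[mN mQ] mn uR.
  have uR' : nm u <= `|R| by rewrite (le_trans uR)// ler_norm.
  have m0 : 0 < m%:R :> K by rewrite ltr0n (leq_trans N00).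
  apply: le_trans (@prod_cauchy _ (tau_part w1 w2 ^~ u) (fun N =>
    \prod_(p <- ring_of N) wfactor u (lat p.1 p.2)) A N0 A0 N00 _ _ m n mN mn) _.
  - by move=> k _; exact: tau_partS.
  - by move=> k kN; exact: HA.
  apply: (@le_trans _ _ (M * expR A * A / m%:R)).
    rewrite ler_pM ?mulr_ge0 ?expR_ge0 ?nm_ge0//.
    - by rewrite subr_ge0 lef_pV2 ?posrE ?ler_nat// ltr0n (leq_trans _ mn)// -(ltr0n K).
    - by rewrite !ler_wpM2r ?expR_ge0// HM// subr0.
    - by rewrite gerBl invr_ge0.
  rewrite ler_pdivrMr// [e * _]mulrC -ler_pdivrMr// -/Q.
  by rewrite ltW// (lt_le_trans (archi_boundP Q0))// ler_nat.
exists (maxn N0 (Num.bound Q)) => n m Nn Nm z zR.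
by case/orP: (leq_total m n) => h; [|rewrite nmC]; exact: key.
Qed.

Definition wtau u : C := lim (tau_part w1 w2 ^~ u @ \oo).

Lemma wtau_ucvg : ucvg (tau_part w1 w2) wtau.
Proof. exact: ucauchy_ucvg tau_ucauchy. Qed.

Lemma smooth_wtau u : smooth wtau u.
Proof. exact: smooth_lim smooth_tau_part wtau_ucvg u. Qed.

Lemma sigma_part_cvg u : sigma_part w1 w2 u @ \oo --> u * wtau u.
Proof.
have -> : sigma_part w1 w2 u = (fun N => u * tau_part w1 w2 N u).
  by apply/funext => N; exact: sigma_partE.
by apply: cvgM; [exact: cvg_cst|exact: (@ucvg_cvg _ _ _ u wtau_ucvg)].
Qed.

Lemma wsigmaE u : wsigma w1 w2 u = u * wtau u.
Proof. exact: cvg_limC (@sigma_part_cvg u). Qed.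

Lemma wsigma_cvg u : sigma_part w1 w2 u @ \oo --> wsigma w1 w2 u.
Proof. by rewrite wsigmaE; exact: sigma_part_cvg. Qed.

Lemma smooth_wsigma u : smooth (wsigma w1 w2) u.
Proof.
have -> : wsigma w1 w2 = (fun u => u * wtau u) by apply/funext => v; exact: wsigmaE.
by move=> k; apply: regM; [exact: reg_id|exact: smooth_wtau].
Qed.

Lemma wtau0 : wtau 0 = 1.
Proof.
apply: cvg_limC; have -> : tau_part w1 w2 ^~ 0 = (fun=> 1 : C).
  apply/funext => N; rewrite /tau_part big1// => p _.
  by rewrite wfactorE mul0r /efac subr0 mul1r expr0n /= mul0r addr0 cexp0.
exact: cvg_cst.
Qed.

(** No partial product vanishes, and from some [N1] on the product moves by at most half of its
    modulus at [N1], so its limit cannot be 0. *)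
Lemma wsigma_neq0 u : ~ in_lattice w1 w2 u -> wsigma w1 w2 u != 0.
Proof.
move=> ul; have u0 : u != 0.
  by apply/eqP => u0; apply: ul; exists 0, 0; rewrite latt00.
rewrite wsigmaE mulf_neq0//.
have tn0 N : tau_part w1 w2 N u != 0.
  rewrite /tau_part prodf_seq_neq0; apply/allP => p _; apply/implyP => p0.
  rewrite wfactorE; apply: efac_neq0; apply/eqP => u1; apply: ul.
  by exists p.1, p.2; rewrite -[RHS]mul1r -u1 divfK// latt_neq0.
have [A [N0 [A0 N00 HA]]] := ring_factor (nm u).
(* The relative change after [N1] is at most [Q / (2 * N1)], hence at most 1/2 once [Q <= N1]. *)
pose Q := 2 * (expR A * A); have Q0 : 0 <= Q by rewrite !mulr_ge0// expR_ge0.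
pose N1 := maxn N0 (maxn 1 (Num.bound Q)).
have N10 : (0 < N1)%N by rewrite !leq_max orbT.
have N1p : 0 < N1%:R :> K by rewrite ltr0n.
have QN : Q <= N1%:R.
  by rewrite ltW// (lt_le_trans (archi_boundP Q0))// ler_nat !leq_max leqnn !orbT.
have H n : (N1 <= n)%N -> nm (tau_part w1 w2 N1 u) / 2 <= nm (tau_part w1 w2 n u).
  move=> Nn; pose y : K := N1%:R^-1 - n%:R^-1.
  have E : nm (tau_part w1 w2 N1 u) * expR A * A * y =
    nm (tau_part w1 w2 N1 u) / 2 * (Q * y) by rewrite /Q; field.
  have K1 : nm (tau_part w1 w2 n u - tau_part w1 w2 N1 u) <=
      nm (tau_part w1 w2 N1 u) / 2 * (Q * y).
    rewrite -E; apply: (@prod_cauchy _ (tau_part w1 w2 ^~ u) (fun N =>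
      \prod_(p <- ring_of N) wfactor u (lat p.1 p.2)) A N1 A0 N10 _ _ N1 n) => //.
      by move=> k Nk; exact: tau_partS.
    by move=> k Nk; apply: HA => //; apply: leq_trans Nk; rewrite leq_max leqnn.
  have K2 : Q * y <= 1.
    apply: (@le_trans _ _ (Q / N1%:R)); last by rewrite ler_pdivrMr// mul1r.
    by rewrite ler_wpM2l// gerBl invr_ge0.
  have K3 := ler_wpM2l (divr_ge0 (nm_ge0 (tau_part w1 w2 N1 u)) (ler0n _ 2)) K2.
  have := nmB (tau_part w1 w2 n u) (tau_part w1 w2 n u - tau_part w1 w2 N1 u).
  by rewrite opprB addrC subrK; lra.
have a0 : 0 < nm (tau_part w1 w2 N1 u) / 2 by rewrite divr_gt0// nm_gt0.
have /cvg_disc/(_ _ a0)[N2 H2] := @ucvg_cvg _ _ _ u wtau_ucvg.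
have h1 := H (maxn N1 N2) (leq_maxl _ _); have h2 := H2 (maxn N1 N2) (leq_maxr _ _).
apply/eqP => t0; move: h2; rewrite t0 subr0; lra.
Qed.

Lemma wsigma_lattice u : in_lattice w1 w2 u -> wsigma w1 w2 u = 0.
Proof.
move=> [m [n ->]]; rewrite wsigmaE.
have [/eqP|p0] := boolP ((m, n) == (0, 0)); first by case=> -> ->; rewrite latt00 mul0r.
suff -> : wtau (lat m n) = 0 by rewrite mulr0.
apply: cvg_limC; apply/cvg_disc => e e0; exists (maxn `|m| `|n|) => N.
rewrite geq_max => /andP[mN nN]; rewrite subr0.
suff -> : tau_part w1 w2 N (lat m n) = 0 by rewrite nm0.
apply/eqP; rewrite prodf_seq_eq0; apply/hasP; exists (m, n).
  by rewrite mem_sq mN.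
rewrite p0 /= wfactorE divff ?(latt_neq0 p0)//.
by rewrite /efac subrr mul0r.
Qed.

End Sigma.

(** * Quasi-periodicity *)

Section FieldIdentities.
Variable F : fieldType.
Implicit Types u v s t l w : F.

Lemma cross_assemble (a b m n e f g h a' b' m' n' e' f' g' h' t : F) :
  e * f * (g * h) = e' * f' * (g' * h') ->
  a * b * (m * n) = a' * b' * (m' * n') * t ->
  a * e * (b * f) * (m * g * (n * h)) =
  a' * e' * (b' * f') * (m' * g' * (n' * h')) * t.
Proof.
move=> E A; transitivity (a * b * (m * n) * (e * f * (g * h))); first by ring.
by rewrite E A; ring.
Qed.

(** The case of the grid point [w = 0], where the factor of sigma is the variable itself. *)
Lemma cross_ratio0 u v s t l : - u != 0 -> - v != 0 -> - l - s != 0 -> - l - t != 0 ->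
  (u + l) * (v + l) * (s * t) = u * v * ((s + l) * (t + l)) *
  ((- l - u) * (- l - v) / ((- l - s) * (- l - t)) / (- u * - v / (- s * - t))).
Proof.
rewrite !oppr_eq0 => u0 v0 s0 t0.
have -> : s + l = - (- l - s) by ring.
have -> : t + l = - (- l - t) by ring.
have -> : - l - u = - (u + l) by ring.
have -> : - l - v = - (v + l) by ring.
move: (- l - s) (- l - t) (u + l) (v + l) s0 t0 => p q m n p0 q0.
by rewrite !mulrNN invf_div; field; rewrite u0 v0 p0 q0.
Qed.

(** Shifting the variable by [l] is shifting the lattice point by [- l], since
    [w - (z + l) = (w - l) - z]; the correction is thus a quotient of one function at [w - l] and at
    [w]. *)
Lemma cross_ratio u v s t l w : w != 0 -> w - u != 0 -> w - v != 0 ->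
  w - l - s != 0 -> w - l - t != 0 ->
  (1 - (u + l) / w) * (1 - (v + l) / w) * ((1 - s / w) * (1 - t / w)) =
  (1 - u / w) * (1 - v / w) * ((1 - (s + l) / w) * (1 - (t + l) / w)) *
  ((w - l - u) * (w - l - v) / ((w - l - s) * (w - l - t)) /
     ((w - u) * (w - v) / ((w - s) * (w - t)))).
Proof.
move=> w0 u0 v0 s0 t0; rewrite invf_div.
have E x : 1 - x / w = (w - x) / w by rewrite mulrBl divff.
have El x : w - (x + l) = w - l - x by ring.
rewrite !E !El.
move: (w - u) (w - v) (w - l - s) (w - l - t) (w - s) (w - t) (w - l - u) (w - l - v)
  u0 v0 s0 t0 => a b m n p q x y a0 b0 m0 n0.
by field; rewrite w0 a0 b0 m0 n0.
Qed.

(** The change of [e u + e v] under the shift depends on [u + v] only: the quadratic part changes by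
    a multiple of [l * (u + v) + l ^+ 2]. *)
Lemma cross_exponent u v s l w (h : 2%:R != 0 :> F) : w != 0 ->
  let e z := z / w + z ^+ 2 / (2%:R * w ^+ 2) in
  e (u + l) + e (v + l) + (e s + e (u + v - s)) =
  e u + e v + (e (s + l) + e (u + v - s + l)).
Proof. by move=> w0 /=; field; rewrite w0 h. Qed.

End FieldIdentities.

Section Quasiperiod.
Variable K : realType.
Local Notation C := K[i].
Implicit Types (z w u v t : C) (c e d r M x y : K) (f g : C -> C).

(** With [t = w2 / w1], the imaginary part of [m + n t] is [n y], which bounds [n]; then
    [|m| <= |m + n t| + |n| |t|] bounds [m] and yields the constant [a]. *)
Lemma gap_exists (w1 w2 : C) : 0 < complex.Im (w2 / w1) ->
  exists2 c, 0 < c & gap w1 w2 c.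
Proof.
set t := w2 / w1; set y := complex.Im t => y0.
have w10 : w1 != 0.
  by apply/eqP => w10; move: y0; rewrite /y /t w10 invr0 mulr0 ltxx.
have n1 : 0 < nm w1 by rewrite nm_gt0.
have t0 := nm_ge0 t; have yt0 : 0 <= nm t / y by rewrite divr_ge0// ltW.
pose a := (1 + nm t / y)^-1; have a0 : 0 < a by rewrite invr_gt0; lra.
have m0 : 0 < Num.min y a by rewrite lt_min y0.
exists (2 * nm w1 * Num.min y a); first by rewrite !mulr_gt0.
move=> m n.
have E : nm (latt w1 w2 m n) = 2 * nm w1 * nm (m%:~R + n%:~R * t).
  have -> : latt w1 w2 m n = 2 * w1 * (m%:~R + n%:~R * t).
    by rewrite /latt /t; field.
  by rewrite !nmM nm_nat.
have nmz (k : int) : nm (k%:~R : C) = (`|k|%N)%:R.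
  by rewrite -(rmorph_int (real_complex K)) nm_real -intr_norm natr_absz.
have H2 : y * (`|n|%N)%:R <= nm (m%:~R + n%:~R * t).
  apply: le_trans (nm_Im _).
  have -> : complex.Im (m%:~R + n%:~R * t) = n%:~R * y.
    rewrite -!(rmorph_int (real_complex K)) /y; case: (t) => p q /=; ring.
  by rewrite normrM mulrC -intr_norm natr_absz (gtr0_norm y0).
have H1 : a * (`|m|%N)%:R <= nm (m%:~R + n%:~R * t).
  rewrite mulrC ler_pdivrMr; last lra.
  have := nmB (m%:~R + n%:~R * t) (n%:~R * t); rewrite addrK nmM !nmz.
  have : (`|n|%N)%:R <= nm (m%:~R + n%:~R * t) / y by rewrite ler_pdivlMr// mulrC.
  move=> /(ler_wpM2r t0); lra.
have n2 : 0 < 2 * nm w1 by rewrite mulr_gt0.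
rewrite E -!(mulrA (2 * nm w1)) !(ler_pM2l n2); split.
  by apply: le_trans H1; rewrite ler_wpM2r ?ler0n// ge_min lexx orbT.
by apply: le_trans H2; rewrite ler_wpM2r ?ler0n// ge_min lexx.
Qed.

Lemma lattC (w1 w2 : C) m n : latt w2 w1 m n = latt w1 w2 n m.
Proof. by rewrite /latt addrC. Qed.

Lemma gapC (w1 w2 : C) c : gap w1 w2 c -> gap w2 w1 c.
Proof. by move=> H m n; rewrite lattC; have [] := H n m. Qed.

Lemma wsigmaC (w1 w2 : C) : wsigma w2 w1 = wsigma w1 w2.
Proof.
apply/funext => u; rewrite /wsigma.
suff -> : sigma_part w2 w1 u = sigma_part w1 w2 u by [].
apply/funext => N; rewrite /sigma_part exchange_big; congr (_ * _).
apply: eq_bigr => i _; apply: eq_bigr => j _.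
by rewrite andbC lattC.
Qed.

Variables (w1 w2 : C) (c : K).
Hypothesis c0 : 0 < c.
Hypothesis cgap : gap w1 w2 c.
Local Notation lat := (latt w1 w2).
Local Notation sigma := (wsigma w1 w2).

Lemma in_latticeD u v : in_lattice w1 w2 u -> in_lattice w1 w2 v ->
  in_lattice w1 w2 (u + v).
Proof.
by move=> [m [n ->]] [m' [n' ->]]; exists (m + m'), (n + n'); rewrite lattD.
Qed.

Lemma in_latticeN u : in_lattice w1 w2 u -> in_lattice w1 w2 (- u).
Proof. by move=> [m [n ->]]; exists (- m), (- n); rewrite lattN. Qed.

Lemma in_lattice0 : in_lattice w1 w2 0.
Proof. by exists 0, 0; rewrite latt00. Qed.

Lemma in_lattice_shift m n u : in_lattice w1 w2 (u + lat m n) <-> in_lattice w1 w2 u.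
Proof.
have l : in_lattice w1 w2 (lat m n) by exists m, n.
split => h; last exact: in_latticeD.
by rewrite -(addrK (lat m n) u); apply: in_latticeD => //; exact: in_latticeN.
Qed.

Lemma wsigmaN u : sigma (- u) = - sigma u.
Proof.
rewrite !(wsigmaE c0 cgap) mulNr; congr (- (_ * _)).
rewrite /wtau.
suff -> : (fun N => tau_part w1 w2 N (- u)) = (fun N => tau_part w1 w2 N u) by [].
apply/funext => N.
pose neg (p : int * int) := (- p.1, - p.2).
have negK : involutive neg by move=> [m n]; rewrite /neg /= !opprK.
rewrite /tau_part (perm_big (map neg (sq N))); last first.
  have injn : injective neg := inv_inj negK.
  apply: uniq_perm; rewrite ?(map_inj_uniq injn) ?sq_uniq //.
  by move=> p; rewrite -{2}(negK p) (mem_map injn) !mem_sq /= !abszN.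
rewrite big_map; apply: eq_big => p.
  by rewrite !xpair_eqE !oppr_eq0.
by move=> _; rewrite !wfactorE lattN invrN mulrNN.
Qed.

(* [sigma_part] is the product of [prim u w] over the whole grid, the factor at
   [w = 0] being [u] itself. *)
Definition prim u w : C := if w == 0 then u else wfactor u w.

Lemma sigma_part_prim N u :
  sigma_part w1 w2 u N = \prod_(p <- sq N) prim u (lat p.1 p.2).
Proof.
rewrite sigma_partE (bigD1_seq (0, 0)) ?sq_uniq ?mem_sq//=.
rewrite latt00 /prim eqxx /tau_part; congr (_ * _).
by apply: eq_bigr => p /(latt_neq0 c0 cgap)/negPf ->.
Qed.

Section FourTerm.
Variables (u v u' v' : C).
Hypothesis uv : u + v = u' + v'.
Hypotheses (ul : ~ in_lattice w1 w2 u) (vl : ~ in_lattice w1 w2 v).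
Hypotheses (ul' : ~ in_lattice w1 w2 u') (vl' : ~ in_lattice w1 w2 v').
Local Notation L := (2%:R * w1).

(** Because [u + v = u' + v'], the terms of order [1 / w] cancel and [S w = 1 + O(1/w^2)] at
    infinity. *)
Let S w := (w - u) * (w - v) / ((w - u') * (w - v')).

Let T w := S (w - L) / S w.

Lemma lat_neq m n z : ~ in_lattice w1 w2 z -> lat m n - z != 0.
Proof. by move=> h; rewrite subr_eq0; apply/eqP => e; apply: h; exists m, n. Qed.

Lemma lat_shift m n : lat m n - L = lat (m - 1) n.
Proof. by rewrite /latt !rmorphB /=; ring. Qed.

Lemma S_neq0 m n : S (lat m n) != 0.
Proof. by rewrite /S !(mulf_neq0, invr_neq0)// lat_neq. Qed.

(* The exponential factors cancel because [u + v = u' + v']. *)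
Lemma prim_cross m n :
  prim (u + L) (lat m n) * prim (v + L) (lat m n) *
    (prim u' (lat m n) * prim v' (lat m n)) =
  prim u (lat m n) * prim v (lat m n) *
    (prim (u' + L) (lat m n) * prim (v' + L) (lat m n)) * T (lat m n).
Proof.
have h1 := lat_neq m n ul; have h2 := lat_neq m n vl.
have h3 := lat_neq m n ul'; have h4 := lat_neq m n vl'.
have h5 := lat_neq (m - 1) n ul; have h6 := lat_neq (m - 1) n vl.
have h7 := lat_neq (m - 1) n ul'; have h8 := lat_neq (m - 1) n vl'.
rewrite -lat_shift in h5 h6 h7 h8.
rewrite /T /S /prim; set w := lat m n in h1 h2 h3 h4 h5 h6 h7 h8 *.
have [w0|w0] := eqVneq w 0.
  by rewrite w0 !sub0r in h1 h2 h3 h4 h5 h6 h7 h8 *; exact: cross_ratio0.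
have ev : v' = u + v - u' by rewrite uv addrAC subrr add0r.
pose E z := cexp (z / w + z ^+ 2 / (2%:R * w ^+ 2)).
have EE : E (u + L) * E (v + L) * (E u' * E v') =
    E u * E v * (E (u' + L) * E (v' + L)).
  rewrite /E -!cexpD ev; congr cexp.
  by apply: (cross_exponent _ _ _ _ _ w0); rewrite pnatr_eq0.
have -> z : wfactor z w = (1 - z / w) * E z by [].
exact: (cross_assemble EE (cross_ratio w0 h1 h2 h7 h8)).
Qed.

(** For fixed [n] the product over [m] telescopes, leaving only the column [m = N] and the column
    [m = - N - 1] just outside the square. *)
Lemma prod_T N : \prod_(p <- sq N) T (lat p.1 p.2) =
  \prod_(n <- zs N) S (lat (- N.+1%:Z) n) / \prod_(n <- zs N) S (lat N%:Z n).
Proof.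
rewrite /sq big_allpairs_dep /= exchange_big /= -prodf_div.
apply: eq_bigr => n _; rewrite /zs big_map.
have -> : iota 0 N.*2.+1 = index_iota 0 N.*2.+1 by rewrite /index_iota subn0.
pose f (k : nat) := S (lat (k%:Z - N.+1%:Z) n).
have -> : S (lat (- N.+1%:Z) n) / S (lat N%:Z n) = f 0%N / f N.*2.+1.
  by rewrite /f sub0r; congr (_ / S (lat _ _)); lia.
rewrite -(@telescope_prodr _ 0 N.*2.+1 f)//; last first.
  by move=> k _; rewrite unitfE S_neq0.
apply: eq_bigr => k _; rewrite /T lat_shift /f.
by congr (S (lat _ _) / S (lat _ _)); lia.
Qed.

(** A column has 2N + 1 points, and on it [S] differs from 1 by O(1/N^2). The map [M] covers both
    boundary columns. *)
Lemma prod_S_cvg (M : nat -> int) : (forall N, (N <= `|M N|)%N) ->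
  (fun N => \prod_(n <- zs N) S (lat (M N) n)) @ \oo --> (1 : C).
Proof.
move=> MN; apply/cvg_disc => e e0.
pose q := nm (u * v - u' * v'); have q0 : 0 <= q by exact: nm_ge0.
(* 24 = 3 * 2 * 4: [2N + 1 <= 3N] points, the 2 of [nm_prod_sub1], and the 4 from halving two
   distances in [d]. *)
pose A := 24 * q / c ^+ 2.
have c20 : 0 < c ^+ 2 by rewrite exprn_gt0.
have A0 : 0 <= A by rewrite divr_ge0 ?mulr_ge0// ltW.
(* For [N] beyond [B], [u'] and [v'] are at most half of [c * N], so [w - u'] and [w - v'] have
   modulus at least [c * N / 2]. *)
pose B := 2 * (nm u' + nm v') / c.
have B0 : 0 <= B by rewrite divr_ge0 ?mulr_ge0 ?addr_ge0 ?nm_ge0// ltW.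
have Ae : 0 <= A / e by rewrite divr_ge0// ltW.
exists (maxn (maxn 1 (Num.bound B)) (maxn (Num.bound A) (Num.bound (A / e)))) => N.
rewrite !geq_max => /andP[/andP[N1 NB] /andP[NA NE]].
have n0 : 0 < N%:R :> K by rewrite ltr0n.
have n1 : 1 <= N%:R :> K by rewrite ler1n.
have AN : A < N%:R by rewrite (lt_le_trans (archi_boundP A0))// ler_nat.
have BN : B < N%:R by rewrite (lt_le_trans (archi_boundP B0))// ler_nat.
have AeN : A / e < N%:R by rewrite (lt_le_trans (archi_boundP Ae))// ler_nat.
pose x := c * N%:R; have x0 : 0 < x by rewrite mulr_gt0.
have ux : 2 * (nm u' + nm v') <= x.
  by move: BN; rewrite /B ltr_pdivrMr// [_ * c]mulrC => /ltW.
pose d := q * (4 / x ^+ 2).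
have d0 : 0 <= d by rewrite mulr_ge0// divr_ge0// exprn_ge0// ltW.
have hs (n : int) : nm (S (lat (M N) n) - 1) <= d.
  have h3 := lat_neq (M N) n ul'; have h4 := lat_neq (M N) n vl'.
  have wx : x <= nm (lat (M N) n).
    apply: le_trans (proj1 (cgap _ _)); rewrite ler_pM2l// ler_nat; exact: MN.
  have -> : S (lat (M N) n) - 1 =
      (u * v - u' * v') * (((lat (M N) n) - u') * ((lat (M N) n) - v'))^-1.
    have ev : v = u' + v' - u by rewrite -uv addrAC subrr add0r.
    by rewrite /S ev; field; rewrite h3 h4.
  rewrite nmM nmV nmM /d ler_wpM2l//.
  have p1 : x / 2 <= nm (lat (M N) n - u').
    have := nmD (lat (M N) n - u') u'; rewrite subrK; have := nm_ge0 v'; lra.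
  have p2 : x / 2 <= nm (lat (M N) n - v').
    have := nmD (lat (M N) n - v') v'; rewrite subrK; have := nm_ge0 u'; lra.
  have x20 : 0 < x / 2 by rewrite divr_gt0.
  have -> : 4 / x ^+ 2 = (x / 2 * (x / 2))^-1 by field; exact: lt0r_neq0.
  have q1 := lt_le_trans x20 p1; have q2 := lt_le_trans x20 p2.
  rewrite lef_pV2 ?posrE; [|exact: mulr_gt0..].
  by apply: ler_pM => //; exact: ltW.

have kd : (size (zs N))%:R * (2 * d) <= A / N%:R.
  have -> : A / N%:R = (3 * N%:R) * (2 * d).
    by rewrite /A /d /x; field; rewrite !lt0r_neq0.
  apply: ler_wpM2r; first by rewrite mulr_ge0.
  by rewrite size_zs -addnn -addnS natrD -natr1; lra.
have kd1 : A / N%:R <= 1 by rewrite ler_pdivrMr// mul1r ltW.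
apply: le_lt_trans (nm_prod_sub1 d0 (fun n _ => hs n) (le_trans kd kd1)) _.
by apply: le_lt_trans kd _; rewrite ltr_pdivrMr// mulrC -ltr_pdivrMr.
Qed.

Lemma four_term_off :
  sigma (u + L) * sigma (v + L) * (sigma u' * sigma v') =
  sigma u * sigma v * (sigma (u' + L) * sigma (v' + L)).
Proof.
have sc z := wsigma_cvg c0 cgap (u := z).
have cv : (fun N => sigma_part w1 w2 (u + L) N * sigma_part w1 w2 (v + L) N *
    (sigma_part w1 w2 u' N * sigma_part w1 w2 v' N) *
    \prod_(n <- zs N) S (lat N%:Z n)) @ \oo -->
  sigma (u + L) * sigma (v + L) * (sigma u' * sigma v') * 1.
  apply: cvgM; last exact: (@prod_S_cvg (fun N => N%:Z)).
  by apply: cvgM; apply: cvgM; exact: sc.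
have cv' : (fun N => sigma_part w1 w2 u N * sigma_part w1 w2 v N *
    (sigma_part w1 w2 (u' + L) N * sigma_part w1 w2 (v' + L) N) *
    \prod_(n <- zs N) S (lat (- N.+1%:Z) n)) @ \oo -->
  sigma u * sigma v * (sigma (u' + L) * sigma (v' + L)) * 1.
  apply: cvgM; last by apply: (@prod_S_cvg (fun N => - N.+1%:Z)) => N; lia.
  by apply: cvgM; apply: cvgM; exact: sc.
(* Each boundary product multiplies its own side, so the two sequences are equal term by term and no
   limit is divided. *)
rewrite -[LHS]mulr1 -[RHS]mulr1; apply: cvg_uniqueC cv _.
rewrite [X in X @ \oo](_ : _ = (fun N => sigma_part w1 w2 u N * sigma_part w1 w2 v N *
    (sigma_part w1 w2 (u' + L) N * sigma_part w1 w2 (v' + L) N) *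
    \prod_(n <- zs N) S (lat (- N.+1%:Z) n)))//.
have X N z1 z2 z3 z4 : sigma_part w1 w2 z1 N * sigma_part w1 w2 z2 N *
    (sigma_part w1 w2 z3 N * sigma_part w1 w2 z4 N) = \prod_(p <- sq N)
    (prim z1 (lat p.1 p.2) * prim z2 (lat p.1 p.2) *
      (prim z3 (lat p.1 p.2) * prim z4 (lat p.1 p.2))).
  by rewrite !sigma_part_prim -!big_split.
apply/funext => N; rewrite !X (eq_bigr _ (fun p _ => prim_cross p.1 p.2)).
rewrite [in LHS]big_split /= prod_T -mulrA; congr (_ * _).
rewrite divfK//; rewrite prodf_seq_neq0; apply/allP => n _; exact: S_neq0.
Qed.

End FourTerm.

Lemma four_term u v u' v' : u + v = u' + v' ->
  sigma (u + 2%:R * w1) * sigma (v + 2%:R * w1) * (sigma u' * sigma v') =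
  sigma u * sigma v * (sigma (u' + 2%:R * w1) * sigma (v' + 2%:R * w1)).
Proof.
move=> uv; have E : 2%:R * w1 = lat 1 0 by rewrite /latt; ring.
(* If one of the four points is in the lattice, so is its shift; one of the two values occurs on
   each side, and both sides vanish. *)
have z z : in_lattice w1 w2 z -> sigma z = 0 /\ sigma (z + 2%:R * w1) = 0.
  move=> h; split; apply: (wsigma_lattice c0 cgap) => //.
  by rewrite E; apply/in_lattice_shift.
have [/z[-> ->]|ul] := pselect (in_lattice w1 w2 u); first by rewrite !mul0r.
have [/z[-> ->]|vl] := pselect (in_lattice w1 w2 v); first by rewrite !(mul0r, mulr0).
have [/z[-> ->]|ul'] := pselect (in_lattice w1 w2 u'); first by rewrite !(mul0r, mulr0).
have [/z[-> ->]|vl'] := pselect (in_lattice w1 w2 v'); first by rewrite !(mul0r, mulr0).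
exact: four_term_off.
Qed.

End Quasiperiod.

(** * The addition formula for zeta *)

Section FieldIdentities.
Variable F : fieldType.
Implicit Types a b k l m n p q r s t x : F.

Lemma divB_cross a b p q : p != 0 -> q != 0 ->
  a / p - b / q = (a * q - p * b) / (p * q).
Proof. by move=> p0 q0; field; rewrite p0 q0. Qed.

Lemma div_cross p q m n : p != 0 -> q != 0 -> p * m = q * n -> n / p = m / q.
Proof.
by move=> p0 q0 E; apply/eqP; rewrite eqr_div// mulrC -E mulrC.
Qed.

Lemma residue_cancel a b x : a != 0 -> b != 0 -> x != 0 ->
  1 + x / (a * b) * (- a * - b) / - x = 0.
Proof.
by move=> a0 b0 x0; rewrite mulrNN divfK ?mulf_neq0// invrN mulrN divff// subrr.
Qed.

Lemma clear_pole a p s q r t : p != 0 -> q != 0 ->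
  (a - p * (r + t) + s / q) / p = a / p - r - t + s / (p * q).
Proof. by move=> p0 q0; field; rewrite p0 q0. Qed.

Lemma eq_div_cross a b p q k : p != 0 -> q != 0 -> a * q = b * p ->
  k * a / p = k * b / q.
Proof. by move=> p0 q0 E; rewrite -!mulrA; congr (_ * _); apply/eqP; rewrite eqr_div// E. Qed.

Lemma addition_form a b m n p q r s x k l :
  a - - b - (m - - n) + x / (p * r) * (k * l) / (q * - s) = 0 ->
  b + a - n - m = x * k * l / (p * q * r * s).
Proof.
move=> /eqP; rewrite addr_eq0 => /eqP E.
have -> : b + a - n - m = a - - b - (m - - n) by ring.
by rewrite E mulrN invrN mulrN opprK !invfM; ring.
Qed.

End FieldIdentities.

Section ZetaIdentity.
Variable K : realType.
Local Notation C := K[i].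
Implicit Types (z u v t : C) (d r M y : K) (f g : C -> C).
Variables (w1 w2 : C) (c : K).
Hypothesis c0 : 0 < c.
Hypothesis cgap : gap w1 w2 c.
Local Notation lat := (latt w1 w2).
Local Notation sigma := (wsigma w1 w2).
Local Notation zeta := (wzeta w1 w2).
Local Notation dsigma := (derive1 (wsigma w1 w2)).
Local Notation period L := (L = 2%:R * w1 \/ L = 2%:R * w2).

Lemma period_lat L : period L -> exists m n, L = lat m n.
Proof.
by move=> [->|->]; [exists 1, 0|exists 0, 1]; rewrite /latt; ring.
Qed.

Lemma four_term_period L u v u' v' : period L -> u + v = u' + v' ->
  sigma (u + L) * sigma (v + L) * (sigma u' * sigma v') =
  sigma u * sigma v * (sigma (u' + L) * sigma (v' + L)).
Proof.
move=> [->|->]; first exact: (four_term c0 cgap).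
by move=> /(four_term c0 (gapC cgap)); rewrite (wsigmaC w1 w2).
Qed.

Lemma in_lattice_period L u : period L ->
  in_lattice w1 w2 (u + L) <-> in_lattice w1 w2 u.
Proof. by move=> /period_lat[m [n ->]]; exact: in_lattice_shift. Qed.

Let ss u : smooth sigma u. Proof. exact: (smooth_wsigma c0 cgap). Qed.
Let hs u : hol sigma u. Proof. by apply: entire_hol. Qed.
Let hds u : hol dsigma u. Proof. exact: hol_derive1. Qed.
Let s0 u (h : ~ in_lattice w1 w2 u) : sigma u != 0.
Proof. exact: (wsigma_neq0 c0 cgap). Qed.

Lemma derive1_sigma_pair u v :
  derive1 (fun t => sigma (u + t) * sigma (v - t)) 0 =
  dsigma u * sigma v - sigma u * dsigma v.
Proof.
pose f t : C := u + t; pose g t : C := v - t.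
have rf : reg 1 f 0 by apply: regD; [exact: reg_cst|exact: reg_id].
have rg : reg 1 g 0 by apply: regB; [exact: reg_cst|exact: reg_id].
have sf : reg 1 sigma (f 0) by exact: ss.
have sg : reg 1 sigma (g 0) by exact: ss.
rewrite (derive1M (reg_comp sf rf) (reg_comp sg rg)).
rewrite (derive1_chain sf rf) (derive1_chain sg rg).
have -> : derive1 f 0 = 1.
  by rewrite (derive1D (reg_cst 1 u 0) (reg_id 1 0)) derive1C derive1_idC add0r.
have -> : derive1 g 0 = -1.
  by rewrite (derive1B (reg_cst 1 v 0) (reg_id 1 0)) derive1C derive1_idC sub0r.
have -> : f 0 = u by rewrite /f addr0.
have -> : g 0 = v by rewrite /g subr0.
move: (dsigma u) (dsigma v) (sigma u) (sigma v) => a b p q.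
ring.
Qed.

(* Derivative of the four-term relation along [u' = u + t, v' = v - t]. *)
Lemma zeta_shift L u v : period L -> ~ in_lattice w1 w2 u -> ~ in_lattice w1 w2 v ->
  zeta (u + L) - zeta (v + L) = zeta u - zeta v.
Proof.
move=> pL ul vl.
have uL : sigma (u + L) != 0 by apply: s0; rewrite in_lattice_period.
have vL : sigma (v + L) != 0 by apply: s0; rewrite in_lattice_period.
have u0 := s0 ul; have v0 := s0 vl.
have E : (fun t => sigma (u + L) * sigma (v + L) * (sigma (u + t) * sigma (v - t)))
    = (fun t => sigma u * sigma v * (sigma (u + L + t) * sigma (v + L - t))).
  apply/funext => t; rewrite (four_term_period pL (u' := u + t) (v' := v - t)).
    by rewrite -!addrA (addrC L) (addrC (- t)).
  by rewrite addrACA subrr addr0.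
have r a b : reg 1 (fun t => sigma (a + t) * sigma (b - t)) 0.
  apply: regM; apply: reg_comp; try exact: ss.
    by apply: regD; [exact: reg_cst|exact: reg_id].
  by apply: regB; [exact: reg_cst|exact: reg_id].
have := congr1 (fun f => derive1 f 0) E.
rewrite (derive1Z _ (r _ _)) (derive1Z _ (r _ _)) !derive1_sigma_pair => {}E.
have e1 : zeta u - zeta v = (dsigma u * sigma v - sigma u * dsigma v) / (sigma u * sigma v).
  exact: divB_cross.
have e2 : zeta (u + L) - zeta (v + L) =
    (dsigma (u + L) * sigma (v + L) - sigma (u + L) * dsigma (v + L)) /
    (sigma (u + L) * sigma (v + L)).
  exact: divB_cross.
by apply: etrans e2 (etrans _ (esym e1)); apply: div_cross E; exact: mulf_neq0.
Qed.

Lemma sigma0 : sigma 0 = 0.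
Proof. by rewrite (wsigmaE c0 cgap) mul0r. Qed.

Lemma dsigma0 : dsigma 0 = 1.
Proof.
have -> : sigma = (fun u => u * wtau w1 w2 u).
  by apply/funext => u; exact: (wsigmaE c0 cgap).
rewrite (derive1M (reg_id 1 0) (smooth_wtau c0 cgap 0 1)) derive1_idC.
by rewrite mul0r addr0 mul1r wtau0.
Qed.

Lemma dsigmaN u : dsigma (- u) = dsigma u.
Proof.
pose f t : C := - t.
have rf : reg 1 f u by apply: regN; exact: reg_id.
have sf : reg 1 sigma (f u) by exact: ss.
have E : (fun t => sigma (f t)) = (fun t => - sigma t).
  by apply/funext => t; exact: (wsigmaN c0 cgap).
have := congr1 (fun f => derive1 f u) E.
rewrite (derive1_chain sf rf) (derive1_oppC (ss u 1%N)) /f (derive1_oppC (reg_id 1 u)).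
by rewrite derive1_idC mulrN1 => /oppr_inj.
Qed.

Lemma wzetaN u : zeta (- u) = - zeta u.
Proof. by rewrite /wzeta dsigmaN (wsigmaN c0 cgap) invrN mulrN. Qed.

Lemma in_latticeNE u : in_lattice w1 w2 (- u) <-> in_lattice w1 w2 u.
Proof. by split=> /in_latticeN; rewrite ?opprK. Qed.

Lemma near_off_lattice u : ~ in_lattice w1 w2 u ->
  \forall z \near u, ~ in_lattice w1 w2 z.
Proof.
move=> /s0 su; apply: filterS (near_neq0 (smooth_continuous (ss u)) su) => z z0.
by move=> /(wsigma_lattice c0 cgap)/eqP; rewrite (negPf z0).
Qed.

Lemma near0_off_lattice : \forall z \near (0 : C), z != 0 -> ~ in_lattice w1 w2 z.
Proof.
have t0 : wtau w1 w2 0 != 0 by rewrite wtau0 oner_neq0.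
have := near_neq0 (smooth_continuous (smooth_wtau c0 cgap 0)) t0.
apply: filterS => z tz z0 /(wsigma_lattice c0 cgap).
by rewrite (wsigmaE c0 cgap) => /eqP; rewrite mulf_eq0 (negPf z0) (negPf tz).
Qed.

Lemma hol_zeta u : ~ in_lattice w1 w2 u -> hol zeta u.
Proof. by move=> /s0 su; apply: holM; [exact: hds|apply: holV; [|exact: hs]]. Qed.

(** Subtract the integer parts of the real coordinates [a], [b] of [z] in the basis [2 w1], [2 w2];
    the rest lies in a fundamental parallelogram. *)
Lemma lattice_reduce : 0 < complex.Im (w2 / w1) ->
  exists r, forall z, exists m n, nm (z + lat m n) <= r.
Proof.
set t := w2 / w1; set y := complex.Im t => y0.
have w10 : w1 != 0.
  by apply/eqP => w10; move: y0; rewrite /y /t w10 invr0 mulr0 ltxx.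
exists (2 * nm w1 * (1 + nm t)) => z.
pose q := z / (2%:R * w1).
pose b := complex.Im q / y; pose a := complex.Re q - b * complex.Re t.
exists (- Num.floor a), (- Num.floor b).
have E : z + lat (- Num.floor a) (- Num.floor b) =
    2%:R * w1 * ((a - (Num.floor a)%:~R)%:C + (b - (Num.floor b)%:~R)%:C * t).
  have -> : z = 2%:R * w1 * (a%:C + b%:C * t).
    have -> : a%:C + b%:C * t = q.
      rewrite /a /b /y; move: (gt_eqF y0); rewrite /y; case: (t) (q) => t1 t2 [q1 q2] /= t20.
      apply/eqP; rewrite eq_complex /=; apply/andP; split; apply/eqP; field; rewrite t20//.
    by rewrite /q; field.
  rewrite /latt !rmorphB /= !rmorphN /= /t !rmorph_int; field; exact: w10.
rewrite E (nmM (2%:R * w1)) (nmM 2%:R w1) nm_nat.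
apply: ler_wpM2l; first by rewrite mulr_ge0// nm_ge0.
apply: le_trans (nmD _ _) _; rewrite (nmM _ t) !nm_real.
have fr x : `|x - (Num.floor x)%:~R| <= 1 :> K.
  have /andP[h1 h2] := floor_itv x; rewrite intrD in h2.
  by rewrite ger0_norm; lra.
by apply: lerD; [exact: fr|rewrite ler_piMl ?nm_ge0].
Qed.

Section Addition.
Hypothesis hw : 0 < complex.Im (w2 / w1).
Variables (x a : C).
Hypotheses (xl : ~ in_lattice w1 w2 x) (al : ~ in_lattice w1 w2 a).
Hypothesis xal : ~ in_lattice w1 w2 (x - a).

(* [h] is the difference of the two sides of [zeta_addition]; as a function of
   [b] it is elliptic, and its poles, all congruent to [0] or [x], are removable:
   at [0] it equals [(G b / b) / (sigma b / b)] with [G 0 = 0], and [b |-> x - b]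
   exchanges the two classes. *)
Let k := sigma x / (sigma a * sigma (x - a)).
Let cst := zeta a - zeta (a - x).
Let h b := zeta b - zeta (b - x) - cst
  + k * (sigma (b - a) * sigma (b + a - x)) / (sigma b * sigma (b - x)).
Let G b := dsigma b - sigma b * (zeta (b - x) + cst)
  + k * (sigma (b - a) * sigma (b + a - x)) / sigma (b - x).
Let bad b := in_lattice w1 w2 b \/ in_lattice w1 w2 (b - x).
(** All poles receive the same value, the limit of [h] at 0, so periodicity and the symmetry
    [b |-> x - b] are immediate there. *)
Let ht b := if pselect (bad b) then dq G 0 0 / wtau w1 w2 0 else h b.

Lemma ht_good b : ~ in_lattice w1 w2 b -> ~ in_lattice w1 w2 (b - x) -> ht b = h b.
Proof. by rewrite /ht => h1 h2; case: pselect => // -[]. Qed.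

Lemma ht_bad b : bad b -> ht b = dq G 0 0 / wtau w1 w2 0.
Proof. by rewrite /ht; case: pselect. Qed.

Lemma hol_num u : hol (fun b => k * (sigma (b - a) * sigma (b + a - x))) u.
Proof.
apply: holM; first exact: hol_cst.
apply: holM; first by apply: hol_shift; exact: hs.
apply: (@hol_comp _ (fun b => b + a - x)); first exact: hs.
by apply: holD; [apply: holD; [exact: hol_id|exact: hol_cst]|exact: hol_cst].
Qed.

Lemma hol_h u : ~ in_lattice w1 w2 u -> ~ in_lattice w1 w2 (u - x) -> hol h u.
Proof.
move=> ul uxl; apply: holD; last first.
  apply: holM; first exact: hol_num.
  apply: holV; first by rewrite mulf_neq0 ?s0.
  by apply: holM; [exact: hs|apply: hol_shift; exact: hs].
apply: holD; last exact: hol_cst.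
apply: holD; first exact: hol_zeta.
apply: (@hol_eq _ (fun b => -1 * zeta (b - x))).
  by near=> b; rewrite mulN1r.
by apply: holM; [exact: hol_cst|apply: hol_shift; exact: hol_zeta].
Unshelve. all: end_near. Qed.

Lemma hol_G : hol G 0.
Proof.
have xl' : ~ in_lattice w1 w2 (0 - x) by rewrite sub0r in_latticeNE.
apply: holD; last first.
  apply: holM; first exact: hol_num.
  by apply: holV; [exact: s0|apply: hol_shift; exact: hs].
apply: holD; first exact: hds.
apply: (@hol_eq _ (fun b => -1 * (sigma b * (zeta (b - x) + cst)))).
  by near=> b; rewrite mulN1r.
apply: holM; first exact: hol_cst.
apply: holM; first exact: hs.
by apply: holD; [apply: hol_shift; exact: hol_zeta|exact: hol_cst].
Unshelve. all: end_near. Qed.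

(** This is where [k] comes from: it makes the second term equal to -1, cancelling the residue 1 of
    zeta at 0. *)
Lemma G0 : G 0 = 0.
Proof.
rewrite /G dsigma0 sigma0 mul0r subr0 !sub0r add0r.
rewrite -(opprB x a) !(wsigmaN c0 cgap) /k.
by apply: residue_cancel; exact: s0.
Qed.

Lemma smooth_ht0 : smooth ht 0.
Proof.
have t0 : wtau w1 w2 0 != 0 by rewrite wtau0 oner_neq0.
have st := smooth_wtau c0 cgap 0.
have sG := hol_smooth hol_G.
have xl' : ~ in_lattice w1 w2 (- x) by rewrite in_latticeNE.
have near_x : \forall z \near (0 : C), ~ in_lattice w1 w2 (z - x).
  apply: (@near_shift _ (fun w => ~ in_lattice w1 w2 w)).
  by rewrite sub0r; exact: near_off_lattice.
move=> j; apply: (@reg_near _ _ (fun b => dq G 0 b / wtau w1 w2 b)); last first.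
  by apply: regM; [apply: smooth_dq|apply: regV].
apply: filterS3 near_x near0_off_lattice (near_neq0 (smooth_continuous st) t0).
move=> z zx zl tz; have [->|z0] := eqVneq z 0.
  rewrite /ht; case: pselect => // nb; exfalso; apply: nb; left.
  exact: in_lattice0.
rewrite ht_good//; last exact: zl.
have sz := s0 (zl z0); have sx := s0 zx.
have E : dq G 0 z = G z / z by rewrite /dq (negPf z0) G0 !subr0.
rewrite E -mulrA -invfM -(wsigmaE c0 cgap).
exact: clear_pole.
Qed.

Lemma ht_period L b : period L -> ht (b + L) = ht b.
Proof.
move=> pL; have e : b + L - x = b - x + L by rewrite addrAC.
have iff : bad (b + L) <-> bad b.
  rewrite /bad e; have := @in_lattice_period L b pL.
  by have := @in_lattice_period L (b - x) pL; tauto.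
have [bb|nb] := pselect (bad b).
  by rewrite !ht_bad//; apply/iff.
have [nb1 nb2] : ~ in_lattice w1 w2 b /\ ~ in_lattice w1 w2 (b - x).
  by split => hb; apply: nb; [left|right].
have nb1' : ~ in_lattice w1 w2 (b + L) by move=> /(in_lattice_period _ pL).
have nb2' : ~ in_lattice w1 w2 (b + L - x) by rewrite e => /(in_lattice_period _ pL).
rewrite (ht_good nb1' nb2') (ht_good nb1 nb2) /h e.
rewrite (addrAC b L (- a)) (addrAC b L a) (addrAC (b + a) L (- x)).
have -> : zeta (b + L) - zeta (b - x + L) = zeta b - zeta (b - x).
  exact: zeta_shift.
congr (_ + _).
(* Numerator and denominator of the sigma quotient have equal sums of arguments, so the four-term
   relation makes it periodic. *)
have uv : (b - a) + (b + a - x) = b + (b - x) by ring.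
have := four_term_period pL uv.
have := s0 nb1; have := s0 nb2.
have : sigma (b + L) != 0 by apply: s0; rewrite in_lattice_period.
have : sigma (b - x + L) != 0 by apply: s0; rewrite in_lattice_period.
by move=> n1 n2 n3 n4 H; apply: eq_div_cross => //; exact: mulf_neq0.
Qed.

Lemma ht_lattice b m n : ht (b + lat m n) = ht b.
Proof.
have step (L : C) : period L -> forall (j : int) v, ht (v + j%:~R * L) = ht v.
  move=> pL j; elim/int_ind: j => [|j IH|j IH] v.
  - by rewrite mul0r addr0.
  - by rewrite -[RHS]IH -[RHS](ht_period _ pL) intS rmorphD /=; congr ht; ring.
  - by rewrite -[LHS](ht_period _ pL) -[RHS]IH intS opprD rmorphD /=; congr ht; ring.
have -> : b + lat m n = b + m%:~R * (2%:R * w1) + n%:~R * (2%:R * w2).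
  by rewrite /latt; ring.
by rewrite !step; [|left|right].
Qed.

Lemma ht_sym b : ht (x - b) = ht b.
Proof.
have e1 : x - b = - (b - x) by rewrite opprB.
have e2 : x - b - x = - b by rewrite addrAC subrr add0r.
have iff : bad (x - b) <-> bad b.
  rewrite /bad e2 e1; have := @in_latticeNE b.
  by have := @in_latticeNE (b - x); tauto.
have [bb|nb] := pselect (bad b).
  by rewrite !ht_bad//; apply/iff.
have [nb1 nb2] : ~ in_lattice w1 w2 b /\ ~ in_lattice w1 w2 (b - x).
  by split => hb; apply: nb; [left|right].
have nb1' : ~ in_lattice w1 w2 (x - b) by rewrite e1 => /in_latticeNE.
have nb2' : ~ in_lattice w1 w2 (x - b - x) by rewrite e2 => /in_latticeNE.
rewrite (ht_good nb1' nb2') (ht_good nb1 nb2) /h e1.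
have -> : - (b - x) - a = - (b + a - x) by ring.
have -> : - (b - x) + a - x = - (b - a) by ring.
have -> : - (b - x) - x = - b by ring.
rewrite !wzetaN !(wsigmaN c0 cgap) !mulrNN.
by rewrite [sigma (b + a - x) * _]mulrC [sigma (b - x) * _]mulrC; ring.
Qed.

Lemma smooth_ht b : smooth ht b.
Proof.
have lat_case p : in_lattice w1 w2 p -> smooth ht p.
  move=> [m [n pE]]; have E : ht = (fun z => ht (z - p)).
    by apply/funext => z; rewrite -[RHS](ht_lattice _ m n) -pE subrK.
  move=> j; rewrite E; apply: reg_comp; first by rewrite subrr; exact: smooth_ht0.
  by apply: regB; [exact: reg_id|exact: reg_cst].
have [/lat_case//|nb1] := pselect (in_lattice w1 w2 b).
have [bx|nb2] := pselect (in_lattice w1 w2 (b - x)).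
  have E : ht = (fun z => ht (x - z)) by apply/funext => z; rewrite ht_sym.
  move=> j; rewrite E; apply: reg_comp.
    by apply: lat_case; rewrite -opprB in_latticeNE.
  by apply: regB; [exact: reg_cst|exact: reg_id].
apply: hol_smooth; apply: hol_eq (hol_h nb1 nb2).
have near_x : \forall z \near b, ~ in_lattice w1 w2 (z - x).
  apply: (@near_shift _ (fun w => ~ in_lattice w1 w2 w)).
  exact: near_off_lattice.
by apply: filterS2 (near_off_lattice nb1) near_x => z h1 h2; rewrite ht_good.
Qed.

Lemma ht_eq0 b : ht b = 0.
Proof.
have -> : ht b = ht a.
  have [r Hr] := lattice_reduce hw.
  have [|M M0 HM] := @disc_bounded _ ht 0 `|r| (normr_ge0 _).
    by move=> z _; exact/smooth_continuous/smooth_ht.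
  apply: (@liouville _ ht M smooth_ht) => z.
  have [m [n zr]] := Hr z; rewrite -(ht_lattice z m n) HM// subr0.
  by rewrite (le_trans zr)// ler_norm.
rewrite ht_good//; last by rewrite -opprB in_latticeNE.
by rewrite /h (subrr a) sigma0 mul0r mulr0 mul0r addr0 /cst subrr.
Qed.

Lemma zeta_addition b : ~ in_lattice w1 w2 b -> ~ in_lattice w1 w2 (x - b) ->
  zeta (x - b) + zeta b - zeta (x - a) - zeta a =
  sigma x * sigma (a - b) * sigma (x - a - b) /
  (sigma a * sigma b * sigma (x - a) * sigma (x - b)).
Proof.
move=> bl xbl; have := ht_eq0 b; rewrite ht_good//; last first.
  by rewrite -opprB in_latticeNE.
rewrite /h /cst /k => H.
have e1 : b - x = - (x - b) by rewrite opprB.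
have e2 : a - x = - (x - a) by rewrite opprB.
have e3 : b - a = - (a - b) by rewrite opprB.
have e4 : b + a - x = - (x - a - b) by ring.
rewrite e1 e2 e3 e4 !wzetaN !(wsigmaN c0 cgap) mulrNN in H.
exact: addition_form H.
Qed.

End Addition.
End ZetaIdentity.

(** * Wronskians *)

Section Wronskian.
Variable K : realType.
Local Notation C := K[i].
Implicit Types (x z a : C) (f g : C -> C).

Lemma derive1n_eq n f g x : (\forall z \near x, f z = g z) ->
  derive1n n f x = derive1n n g x.
Proof. by move=> H; exact: near_self (derive1n_near n H). Qed.

Lemma derive1nD n f g x : hol f x -> hol g x ->
  derive1n n (fun z => f z + g z) x = derive1n n f x + derive1n n g x.
Proof.
elim: n f g => [//|n IH] f g hf hg; rewrite !derive1Sn -IH; [|exact: hol_derive1..].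
apply: derive1n_eq.
by apply: filterS2 hf hg => z sf sg; rewrite derive1D.
Qed.

Lemma derive1nZ n (k : C) f x : hol f x ->
  derive1n n (fun z => k * f z) x = k * derive1n n f x.
Proof.
elim: n f => [//|n IH] f hf; rewrite !derive1Sn -IH; last exact: hol_derive1.
apply: derive1n_eq.
by apply: filterS hf => z sf; rewrite derive1Z.
Qed.

Lemma derive1n_shift n f x a : derive1n n (fun z => f (z - a)) x = derive1n n f (x - a).
Proof.
have E f' : derive1 (fun z => f' (z - a)) = (fun z => derive1 f' (z - a)).
  apply/funext => z; rewrite /derive1.
  suff -> : (fun h : C => h^-1 *: (f' (h + z - a) - f' (z - a))) =
    (fun h : C => h^-1 *: (f' (h + (z - a)) - f' (z - a))) by [].
  by apply/funext => h; rewrite addrA.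
by elim: n f x => [//|n IH] f x; rewrite derive1Sn E IH -derive1Sn.
Qed.

Lemma binomial_recombine (R : comNzRingType) (F G : nat -> R) n :
  \sum_(k < n.+1) 'C(n, k)%:R * G (n - k)%N * F k.+1 +
  \sum_(k < n.+1) 'C(n, k)%:R * G (n - k).+1 * F k =
  \sum_(k < n.+2) 'C(n.+1, k)%:R * G (n.+1 - k)%N * F k.
Proof.
rewrite [RHS]big_ord_recl [X in _ + X = _]big_ord_recl !bin0 !subn0 addrCA; congr (_ + _).
under [RHS]eq_bigr do rewrite lift0 binS subSS natrD !mulrDl.
rewrite big_split /= addrC; congr (_ + _).
rewrite [RHS]big_ord_recr /= bin_small// !mul0r addr0.
apply: eq_bigr => k _; rewrite /= /bump /= !add1n.
by have -> : (n - k.+1).+1 = (n - k)%N by have := ltn_ord k; lia.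
Qed.

Lemma derive1nM n f g x : hol f x -> hol g x ->
  derive1n n (fun z => f z * g z) x =
  \sum_(k < n.+1) 'C(n, k)%:R * derive1n (n - k) f x * derive1n k g x.
Proof.
elim: n f g => [|n IH] f g hf hg.
  by rewrite big_ord_recl big_ord0 bin0 mul1r addr0.
have hf' := hol_derive1 hf; have hg' := hol_derive1 hg.
rewrite derive1Sn -(binomial_recombine (fun k => derive1n k g x) (fun k => derive1n k f x)).
have -> : derive1n n (derive1 (fun z => f z * g z)) x =
    derive1n n (fun z => f z * derive1 g z + derive1 f z * g z) x.
  apply: derive1n_eq.
  by apply: filterS2 hf hg => z sf sg; rewrite derive1M// addrC.
rewrite derive1nD; [|exact: holM..].
rewrite !IH//; congr (_ + _); apply: eq_bigr => k _; by rewrite -derive1Sn.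
Qed.

Definition wronskian n (f : 'I_n -> C -> C) x : C :=
  \det (\matrix_(i < n, j < n) derive1n i (f j) x).

Lemma wronskian_near n (f g : 'I_n -> C -> C) x :
  (forall j, \forall z \near x, f j z = g j z) -> wronskian f x = wronskian g x.
Proof.
move=> fg; congr (\det _); apply/matrixP => i j; rewrite !mxE.
exact: derive1n_eq.
Qed.

(** By Leibniz's rule the matrix is multiplied on the left by a lower triangular matrix with [g x]
    on the diagonal. *)
Lemma wronskianM n g (f : 'I_n -> C -> C) x : hol g x -> (forall j, hol (f j) x) ->
  wronskian (fun j z => g z * f j z) x = g x ^+ n * wronskian f x.
Proof.
move=> hg hf.
pose L : 'M[C]_n := \matrix_(i < n, k < n) ('C(i, k)%:R * derive1n (i - k) g x).
have -> : wronskian (fun j z => g z * f j z) x =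
    \det (L *m \matrix_(i < n, j < n) derive1n i (f j) x).
  congr (\det _); apply/matrixP => i j; rewrite !mxE derive1nM//.
  rewrite (big_ord_widen n (fun k => 'C(i, k)%:R * derive1n (i - k) g x * derive1n k (f j) x)) //.
  rewrite big_mkcond; apply: eq_bigr => k _; rewrite !mxE.
  by case: ltnP => // ik; rewrite bin_small ?mul0r.
rewrite det_mulmx; congr (_ * _).
have tL : is_trig_mx L.
  by apply/is_trig_mxP => i j ij; rewrite mxE bin_small// mul0r.
rewrite (det_trig tL) -[n in RHS]card_ord -prodr_const.
by apply: eq_bigr => i _; rewrite mxE binn subnn mul1r.
Qed.

Lemma wronskianZ n (k : 'I_n -> C) (f : 'I_n -> C -> C) x : (forall j, hol (f j) x) ->
  wronskian (fun j z => k j * f j z) x = (\prod_j k j) * wronskian f x.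
Proof.
move=> hf; have -> : wronskian (fun j z => k j * f j z) x =
    \det ((\matrix_(i < n, j < n) derive1n i (f j) x) *m diag_mx (\row_j k j)).
  congr (\det _); apply/matrixP => i j; rewrite mul_mx_diag !mxE derive1nZ//.
  by rewrite mulrC.
rewrite det_mulmx det_diag mulrC; congr (_ * _).
by apply: eq_bigr => j _; rewrite mxE.
Qed.

(** The first column is 1 followed by zeros; expanding along it removes the undifferentiated row. *)
Lemma wronskian_one n (f : 'I_n.+1 -> C -> C) x :
  (\forall z \near x, f ord0 z = 1) ->
  wronskian f x = wronskian (fun j => derive1 (f (lift ord0 j))) x.
Proof.
move=> f1; rewrite /wronskian (expand_det_col _ ord0) big_ord_recl big1 => [|i _].
  rewrite addr0 mxE /= (near_self f1) mul1r /cofactor expr0 mul1r.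
  congr (\det _); apply/matrixP => i j; rewrite !mxE.
  by rewrite !lift0 derive1Sn.
rewrite mxE lift0 derive1Sn.
have -> : derive1n i (derive1 (f ord0)) x = derive1n i (fun=> 0) x.
  apply: derive1n_eq; have /near_join := f1.
  by apply: filterS => z /derive1_near ->; exact: derive1C.
have -> : derive1n i (fun=> 0 : C) x = 0.
  elim: (nat_of_ord i) => [//|m IHm]; rewrite derive1Sn.
  by have -> : derive1 (fun=> 0 : C) = (fun=> 0 : C) by apply/funext => z; exact: derive1C.
by rewrite mul0r.
Qed.

Lemma wronskian_shift n (f : 'I_n -> C -> C) x a :
  wronskian (fun j z => f j (z - a)) x = wronskian f (x - a).
Proof.
by congr (\det _); apply/matrixP => i j; rewrite !mxE derive1n_shift.
Qed.

Lemma hol_wronskian n (f : 'I_n -> C -> C) x : (forall j, hol (f j) x) ->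
  hol (wronskian f) x.
Proof.
move=> hf; have -> : wronskian f = (fun z => \sum_(s : {perm 'I_n}) (-1) ^+ s *
    \prod_(i < n) derive1n i (f (s i)) z).
  apply/funext => z; apply: eq_bigr => s _; congr (_ * _).
  by apply: eq_bigr => i _; rewrite mxE.
apply: hol_sum => s; apply: holM; first exact: hol_cst.
by apply: hol_prod => i; exact: hol_derive1n.
Qed.

End Wronskian.

(** * The determinant *)

Section FieldIdentities.
Variable F : fieldType.

Lemma pair_form (A B A' B' z1 z2 x k l p q : F) : p != 0 -> q != 0 ->
  A != 0 -> B != 0 ->
  B' / B + z2 - A' / A - z1 = x * k * l / (p * q * A * B) ->
  (B' * A - B * A' + B * A * (z2 - z1)) * (p * q) = x * k * l.
Proof.
move=> p0 q0 A0 B0 E.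
have -> : B' * A - B * A' + B * A * (z2 - z1) = B * A * (B' / B + z2 - A' / A - z1).
  by field; rewrite A0 B0.
by rewrite E; field; rewrite p0 q0 A0 B0.
Qed.

Lemma ratio_form (p q r s t u v : F) : u != 0 -> q != 0 -> p != 0 -> s != 0 -> r != 0 ->
  t / (r * q) * v / (s / (r * p) * u) = p / q * (t * s^-1 * (v / u)).
Proof. by move=> u0 q0 p0 s0 r0; field; rewrite u0 q0 p0 s0 r0. Qed.

(** [A], [B] stand for sigma at [z - a], [z - b], with derivatives [A'], [B']; [p], [q] for sigma at
    [a], [b]; and [x], [k], [l] for sigma at [z], [a - b], [z - a - b]. *)
Lemma Phi_ratio_form (A B A' B' d x k l p q e1 e2 e3 : F) :
  p != 0 -> q != 0 -> A != 0 ->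
  (B' * A - B * A' + B * A * d) * (p * q) = x * k * l ->
  p / q * ((B' * A^-1 + B * (- A' / A ^+ 2)) * (e1 * e2 * e3) +
     B * A^-1 * (e1 * e2 * e3 * d)) =
  k / q * e1 * (x / A * e3 * (l / (A * q) * e2)).
Proof.
move=> p0 q0 A0 E.
have -> : k / q * e1 * (x / A * e3 * (l / (A * q) * e2)) =
  e1 * e2 * e3 * (x * k * l) / (A ^+ 2 * q ^+ 2) by field; rewrite A0 q0.
by rewrite -E; field; rewrite A0 q0.
Qed.

(** On the left stand, in order, the power of [Phi x a0], the product of the constants [cf], the
    power of [G], and the formula for the remaining parameters at [x - a0]; [s], [t], [s0] are sigma
    at [x], [x - a0], [a0]. *)
Lemma frobenius_step n (s t s0 p q X P e0 e1 e2 : F) :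
  s != 0 -> t != 0 -> s0 != 0 -> q != 0 -> e0 != 0 ->
  (t / (s * s0) * e0) ^+ n.+1 * (p / q * e1 *
    ((s / t * e0^-1) ^+ n * (X * P / (t * q ^+ n) * e2))) =
  X * (p * P) / (s * (s0 ^+ n.+1 * q ^+ n.+1)) * (e0 * (e1 * e2)).
Proof.
move=> hs ht hs0 hq he0; rewrite exprS.
have E : (t / (s * s0) * e0) ^+ n * (s / t * e0^-1) ^+ n = (s0 ^+ n)^-1.
  by rewrite -exprMn -exprVn; congr (_ ^+ n); field; rewrite hs ht hs0 he0.
transitivity ((t / (s * s0) * e0) * (p / q * e1) * (X * P / (t * q ^+ n) * e2) *
  ((t / (s * s0) * e0) ^+ n * (s / t * e0^-1) ^+ n)); first by ring.
rewrite E !exprS.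
have := expf_neq0 n hs0; have := expf_neq0 n hq.
move: (s0 ^+ n) (q ^+ n) => u v u0 v0.
by field; rewrite hs ht hs0 hq u0 v0.
Qed.

Lemma prod_pairs_recl n (f : 'I_n.+1 -> 'I_n.+1 -> F) :
  \prod_(i < n.+1) \prod_(j < n.+1 | (i < j)%N) f i j =
  (\prod_(j < n) f ord0 (lift ord0 j)) *
  \prod_(i < n) \prod_(j < n | (i < j)%N) f (lift ord0 i) (lift ord0 j).
Proof.
rewrite big_ord_recl; congr (_ * _).
  by rewrite big_mkcond big_ord_recl /= mul1r.
apply: eq_bigr => i _; rewrite big_mkcond big_ord_recl /= mul1r [RHS]big_mkcond.
by apply: eq_bigr => j _; rewrite /bump /= !add1n ltnS.
Qed.

End FieldIdentities.

Section Frobenius.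
Variable K : realType.
Local Notation C := K[i].
Variables (w1 w2 : C) (c : K).
Hypothesis c0 : 0 < c.
Hypothesis cgap : gap w1 w2 c.
Hypothesis hw : 0 < complex.Im (w2 / w1).
Local Notation sigma := (wsigma w1 w2).
Local Notation zeta := (wzeta w1 w2).
Local Notation dsigma := (derive1 (wsigma w1 w2)).
Local Notation Lat := (in_lattice w1 w2).
Implicit Types (x y z a b u : C).

Let ss u : smooth sigma u. Proof. exact: (smooth_wsigma c0 cgap). Qed.
Let hs u : hol sigma u. Proof. by apply: entire_hol. Qed.
Let s0 u (h : ~ Lat u) : sigma u != 0.
Proof. exact: (wsigma_neq0 c0 cgap). Qed.

Lemma near_punctured_off_lattice u : \forall z \near u, z != u -> ~ Lat z.
Proof.
have [ul|ul] := pselect (Lat u); last first.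
  by apply: filterS (near_off_lattice c0 cgap ul) => z h _.
have : \forall v \near (u - u), v != 0 -> ~ Lat v.
  by rewrite subrr; exact: (near0_off_lattice c0 cgap).
move=> /near_shift; apply: filterS => z H zu zl.
apply: H; first by rewrite subr_eq0.
by apply: in_latticeD => //; exact: in_latticeN.
Qed.

Lemma hol_dsigma u : hol dsigma u.
Proof. exact: hol_derive1. Qed.

(* [zeta_addition] multiplied out; at the zeros of [sigma (z - a) * sigma (z - b)]
   it is extended by continuity. *)
Lemma sigma_pair a b z : ~ Lat a -> ~ Lat b ->
  (dsigma (z - b) * sigma (z - a) - sigma (z - b) * dsigma (z - a) +
   sigma (z - b) * sigma (z - a) * (zeta b - zeta a)) * (sigma a * sigma b) =
  sigma z * sigma (a - b) * sigma (z - a - b).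
Proof.
move=> al bl.
have hsz e u : hol (fun z => sigma (z - e)) u by apply: hol_shift; exact: hs.
have hdz e u : hol (fun z => dsigma (z - e)) u by apply: hol_shift; exact: hol_dsigma.
pose f z := (dsigma (z - b) * sigma (z - a) + -1 * (sigma (z - b) * dsigma (z - a)) +
   sigma (z - b) * sigma (z - a) * (zeta b - zeta a)) * (sigma a * sigma b).
pose g z := sigma z * sigma (a - b) * sigma (z - (a + b)).
have hf : hol f z.
  apply: holM; last exact: hol_cst.
  apply: holD; last by apply: holM; [apply: holM|exact: hol_cst].
  apply: holD; first by apply: holM.
  by apply: holM; [exact: hol_cst|apply: holM].
have hg : hol g z.
  by apply: holM; [apply: holM; [exact: hs|exact: hol_cst]|exact: hsz].
suff : f z = g z by rewrite /f /g mulN1r opprD addrA.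
apply: continuous_eq_punctured.
- exact: smooth_continuous (hol_smooth hf).
- exact: smooth_continuous (hol_smooth hg).
apply: filterS3 (near_punctured_off_lattice z)
  (near_shift (near_punctured_off_lattice (z - a)))
  (near_shift (near_punctured_off_lattice (z - b))) => y h1 h2 h3 yz.
have yl := h1 yz.
have yal : ~ Lat (y - a) by apply: h2; rewrite (inj_eq (addIr (- a))).
have ybl : ~ Lat (y - b) by apply: h3; rewrite (inj_eq (addIr (- b))).
rewrite /f /g mulN1r opprD addrA.
have := zeta_addition c0 cgap hw yl al yal bl ybl.
by apply: pair_form; exact: s0.
Qed.

Definition formula n (a : 'I_n -> C) x : C :=
  sigma (x - \sum_(j < n) a j)
    * (\prod_(i < n) \prod_(j < n | (i < j)%N) sigma (a i - a j))
    / (sigma x * \prod_(i < n) sigma (a i) ^+ n)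
    * cexp (x * \sum_(j < n) zeta (a j)).

Lemma hol_cexpM x b : hol (fun z => cexp (z * b)) x.
Proof.
apply: (@hol_comp _ (fun z => z * b)).
  by apply: entire_hol => z; exact: smooth_cexp.
by apply: holM; [exact: hol_id|exact: hol_cst].
Qed.

Lemma hol_Phi a x : ~ Lat a -> ~ Lat x -> hol (fun z => Phi w1 w2 z a) x.
Proof.
move=> al xl; apply: holM; last exact: hol_cexpM.
apply: holM; first by apply: hol_shift; exact: hs.
apply: holV; first by apply: mulf_neq0; exact: s0.
by apply: holM; [exact: hs|exact: hol_cst].
Qed.

Lemma hol_formula n (a : 'I_n -> C) x : (forall j, ~ Lat (a j)) -> ~ Lat x ->
  hol (formula a) x.
Proof.
move=> al xl; apply: holM; last exact: hol_cexpM.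
apply: holM.
  by apply: holM; [apply: hol_shift; exact: hs|exact: hol_cst].
apply: holV; last by apply: holM; [exact: hs|exact: hol_cst].
apply: mulf_neq0; first exact: s0.
by apply/prodf_neq0 => i _; apply: expf_neq0; exact: s0.
Qed.

Lemma Phi_neq0 a x : ~ Lat a -> ~ Lat x -> ~ Lat (x - a) -> Phi w1 w2 x a != 0.
Proof.
move=> al xl xal; apply: mulf_neq0; last exact: cexp_neq0.
by apply: mulf_neq0; [exact: s0|rewrite invr_neq0// mulf_neq0// s0].
Qed.

(* [(Phi(., b) / Phi(., a))' = cf a b * G a * Phi(. - a, b)], where only [cf]
   depends on [b]. *)
Let G a x : C := sigma x / sigma (x - a) * cexp (x * - zeta a).
Let cf a b : C := sigma (a - b) / sigma b * cexp (a * zeta b).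

Lemma derive1_Phi_ratio a b z : ~ Lat a -> ~ Lat b -> ~ Lat z -> ~ Lat (z - a) ->
  derive1 (fun y => Phi w1 w2 y b / Phi w1 w2 y a) z =
  cf a b * (G a z * Phi w1 w2 (z - a) b).
Proof.
move=> al bl zl zal; have za := s0 zal.
pose d := zeta b - zeta a.
pose h1 y : C := y - b; pose h2 y : C := y - a; pose h3 y : C := y * d.
pose k := sigma a / sigma b.
(* In the ratio sigma of [y] cancels, and only a quotient of two shifted sigmas and one exponential
   are differentiated. *)
rewrite (@derive1_near _ _ (fun y => k *
    (sigma (h1 y) * (sigma (h2 y))^-1 * cexp (h3 y)))); last first.
  have near_za := near_shift (near_off_lattice c0 cgap zal).
  apply: filterS2 (near_off_lattice c0 cgap zl) near_za => y yl yal.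
  rewrite /Phi /h1 /h2 /h3 /d mulrBr cexpD cexpN.
  have := s0 yl; have := s0 yal; have := s0 al; have := s0 bl.
  have := cexp_neq0 (y * zeta a).
  rewrite /k; move: (sigma a) (sigma b) (sigma y) (sigma (y - a)) (sigma (y - b))
    (cexp (y * zeta a)) (cexp (y * zeta b)) => p q r s t u v *.
  exact: ratio_form.
have r1 : reg 1 h1 z by apply: regB; [exact: reg_id|exact: reg_cst].
have r2 : reg 1 h2 z by apply: regB; [exact: reg_id|exact: reg_cst].
have r3 : reg 1 h3 z by apply: regM; [exact: reg_id|exact: reg_cst].
have d1 : derive1 h1 z = 1.
  by rewrite (derive1B (reg_id 1 z) (reg_cst 1 b z)) derive1C derive1_idC subr0.
have d2 : derive1 h2 z = 1.
  by rewrite (derive1B (reg_id 1 z) (reg_cst 1 a z)) derive1C derive1_idC subr0.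
have d3 : derive1 h3 z = d.
  by rewrite (derive1M (reg_id 1 z) (reg_cst 1 d z)) derive1C derive1_idC mul1r mulr0 addr0.
have g1 : reg 1 sigma (h1 z) by exact: ss.
have g2 : reg 1 sigma (h2 z) by exact: ss.
have g3 : reg 1 (@cexp K) (h3 z) by exact: smooth_cexp.
have c1 := reg_comp g1 r1; have c2 := reg_comp g2 r2; have c3 := reg_comp g3 r3.
have c2' : reg 1 (fun y => (sigma (h2 y))^-1) z.
  exact: (@regV _ 1 (fun y => sigma (h2 y)) z za c2).
have D1 : derive1 (fun y => sigma (h1 y)) z = dsigma (z - b).
  by rewrite (derive1_chain g1 r1) d1; exact: mulr1.
have D2 : derive1 (fun y => sigma (h2 y)) z = dsigma (z - a).
  by rewrite (derive1_chain g2 r2) d2; exact: mulr1.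
have D3 : derive1 (fun y => cexp (h3 y)) z = cexp (h3 z) * d.
  by rewrite (derive1_chain g3 r3) d3 derive1_cexp.
rewrite (derive1Z _ (regM (regM c1 c2') c3)) (derive1M (regM c1 c2') c3).
rewrite (derive1M c1 c2') (@derive1V _ (fun y => sigma (h2 y)) z za c2) D1 D2 D3.
have := sigma_pair z al bl.
have -> : cexp (h3 z) = cexp (z * zeta b) * cexp (z * - zeta a).
  by rewrite /h3 /d mulrDr cexpD.
rewrite /cf /G /Phi.
(* Splits off the exponential belonging to [Phi] at [z - a]; the rest is constant and goes into
   [cf]. *)
have -> : cexp (z * zeta b) = cexp (a * zeta b) * cexp ((z - a) * zeta b).
  by rewrite -cexpD -mulrDl addrC subrK.
rewrite /k /h1 /h2 -/d => E.
exact: (Phi_ratio_form _ _ _ (s0 al) (s0 bl) za E).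
Qed.

Theorem frobenius n (a : 'I_n -> C) x : (forall j, ~ Lat (a j)) -> ~ Lat x ->
  formula a x = wronskian (fun j y => Phi w1 w2 y (a j)) x.
Proof.
elim: n a x => [|n IH] a x al xl.
  rewrite /formula /wronskian det_mx00 !big_ord0 subr0 !mulr1 mulr0 cexp0 mulr1.
  by rewrite divff ?s0.
pose a0 := a ord0; pose a' j := a (lift ord0 j).
have a'l j : ~ Lat (a' j) by exact: al.
have hPhi y : ~ Lat y -> forall j, hol (fun z => Phi w1 w2 z (a j)) y.
  by move=> yl j; exact: hol_Phi.
(* [Phi y a0] vanishes when [y - a0] is in the lattice, so dividing by it is first done off these
   points. *)
have generic y : ~ Lat y -> ~ Lat (y - a0) ->
    formula a y = wronskian (fun j z => Phi w1 w2 z (a j)) y.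
  move=> yl yal.
  have near_y := near_off_lattice c0 cgap yl.
  have near_ya := near_shift (near_off_lattice c0 cgap yal).
  pose r (j : 'I_n.+1) z := Phi w1 w2 z (a j) / Phi w1 w2 z a0.
  have P0 := Phi_neq0 (al ord0) yl yal.
  have hr j : hol (r j) y by apply: holM; [exact: hPhi|apply: holV => //; exact: hPhi].
  have -> : wronskian (fun j z => Phi w1 w2 z (a j)) y =
      wronskian (fun j z => Phi w1 w2 z a0 * r j z) y.
    apply: wronskian_near => j; apply: filterS2 near_y near_ya => z zl zal.
    by rewrite /r mulrC divfK// (Phi_neq0 (al ord0) zl zal).
  rewrite wronskianM//; last exact: hPhi.
  rewrite wronskian_one; last first.
    by apply: filterS2 near_y near_ya => z zl zal; rewrite /r divff// (Phi_neq0 (al ord0) zl zal).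
  have hG : hol (G a0) y.
    apply: holM; last exact: hol_cexpM.
    by apply: holM; [exact: hs|apply: holV; [exact: s0|apply: hol_shift; exact: hs]].
  have hP j : hol (fun z => Phi w1 w2 (z - a0) (a' j)) y.
    by apply: (@hol_shift _ (fun z => Phi w1 w2 z (a' j))); exact: hol_Phi.
  have -> : wronskian (fun j => derive1 (r (lift ord0 j))) y = wronskian
      (fun j z => cf a0 (a' j) * (G a0 z * Phi w1 w2 (z - a0) (a' j))) y.
    apply: wronskian_near => j; apply: filterS2 near_y near_ya => z zl zal.
    exact: (derive1_Phi_ratio (al ord0) (a'l j) zl zal).
  rewrite (wronskianZ (fun j => cf a0 (a' j))); last by move=> j; exact: holM.
  rewrite wronskianM// (wronskian_shift (fun j z => Phi w1 w2 z (a' j))).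
  rewrite -(IH a')//.
  rewrite /formula prod_pairs_recl !big_ord_recl -/a0.
  have -> : \prod_(j < n) cf a0 (a' j) =
      (\prod_(j < n) sigma (a0 - a' j)) / (\prod_(j < n) sigma (a' j)) *
      cexp (a0 * \sum_(j < n) zeta (a' j)).
    by rewrite /cf big_split /= prodf_div mulr_sumr cexp_sum.
  have -> : cexp (y * (zeta a0 + \sum_(j < n) zeta (a' j))) =
      cexp (y * zeta a0) * (cexp (a0 * \sum_(j < n) zeta (a' j)) *
        cexp ((y - a0) * \sum_(j < n) zeta (a' j))).
    by rewrite mulrDr cexpD -[in RHS]cexpD -mulrDl [a0 + _]addrC subrK.
  rewrite opprD addrA /G mulrN cexpN !prodrXl.
  apply/esym; apply: frobenius_step; [exact: s0|exact: s0|exact: (s0 (al ord0))| |exact: cexp_neq0].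
  by apply/prodf_neq0 => i _; exact: s0.
(* Near [x], every [y] other than [x] itself is generic, and both sides are continuous at [x]. *)
apply: (@continuous_eq_punctured _ (formula a)
  (wronskian (fun j z => Phi w1 w2 z (a j)))).
- by apply: smooth_continuous; apply: hol_smooth; exact: hol_formula.
- by apply: smooth_continuous; apply: hol_smooth; apply: hol_wronskian; exact: hPhi.
apply: filterS2 (near_off_lattice c0 cgap xl)
  (near_shift (near_punctured_off_lattice (x - a0))) => y yl h yx.
by apply: generic => //; apply: h; rewrite (inj_eq (addIr (- a0))).
Qed.

End Frobenius.

Theorem theorem9 (K : realType) (w1 w2 : K[i])
  (hw : 0 < complex.Im (w2 / w1)) (n : nat) (hn : (0 < n)%N)
  (x : K[i]) (a : 'I_n -> K[i])
  (hx : ~ in_lattice w1 w2 x) (ha : forall j, ~ in_lattice w1 w2 (a j)) :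
  wsigma w1 w2 (x - \sum_(j < n) a j)
    * (\prod_(i < n) \prod_(j < n | (i < j)%N) wsigma w1 w2 (a i - a j))
    / (wsigma w1 w2 x * \prod_(i < n) (wsigma w1 w2 (a i)) ^+ n)
    * cexp (x * \sum_(j < n) wzeta w1 w2 (a j))
  = \det (\matrix_(i < n, j < n)
            derive1n i (fun y : K[i] => Phi w1 w2 y (a j)) x).
Proof.
have [c c0 cgap] := gap_exists hw.
exact: (frobenius c0 cgap hw ha hx).
Qed.
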